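(* On $\tilde{\mathcal{O}}=\mathbb{R}\times\mathbb{R}^+$ with coordinates $(x_1,x_2)$ and symplectic form $\omega=dx_1\wedge dx_2$, consider the symplectic connection $$\nabla_{\partial_{x_1}}\partial_{x_1}=0,\quad\nabla_{\partial_{x_1}}\partial_{x_2}=\nabla_{\partial_{x_2}}\partial_{x_1}=\tfrac1{2x_2}\partial_{x_1},\quad\nabla_{\partial_{x_2}}\partial_{x_2}=-\tfrac1{2x_2}\partial_{x_2}.$$ The reduced Rankin–Cohen deformation $\sum_{n\ge0}\hbar^nRC_n$ on $\tilde{\mathcal{O}}$, built from $X=\frac1{x_2}\partial_{x_1}$ and $Y=-x_2\partial_{x_2}$, is identical to Fedosov's construction of the star product on $(\tilde{\mathcal{O}},\omega)$ using the connection $\nabla$ with the characteristic form equal to $\frac1{i\hbar}\omega$.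
   Context: Rankin–Cohen brackets. With $(\alpha)_k=\alpha(\alpha+1)\cdots(\alpha+k-1)$ and $[Y,X]=X$, the reduced Rankin–Cohen brackets (the reduction of the Connes–Moscovici Rankin–Cohen deformation to the Lie algebra $h_1$ spanned by $X,Y$) are $$RC_n(a,b)=\sum_{k=0}^n\frac{(-1)^k}{k!}X^k(2Y+k)_{n-k}(a)\;\frac{1}{(n-k)!}X^{n-k}(2Y+n-k)_k(b).$$ Fedosov's construction. On a symplectic manifold $(M,\omega)$ with local coordinates $x^i$ let $W$ be the bundle whose fibre at $x$ consists of formal series $a(y,\hbar)=\sum\hbar^ka_{k,\alpha}y^\alpha$ in tangent vectors $y\in T_xM$, with product $$a\circ b=\exp\Big(-\tfrac{i\hbar}{2}\omega^{ij}\tfrac{\partial}{\partial y^i}\tfrac{\partial}{\partial z^j}\Big)a(y,\hbar)b(z,\hbar)\Big|_{z=y}.$$ On $W$-valued forms let $\delta a=dx^k\wedge\partial a/\partial y^k$, and let $\partial$ be the covariant derivative induced on $W$ by a torsion-free symplectic connection $\nabla$. One constructs a connection $D=-\delta+\partial+\frac i\hbar[r,\cdot]$ on $W$ with $D^2=0$, where $r$ is a $W$-valued 1-form; characteristic form $\frac1{i\hbar}\omega$ means that the (central) characteristic form of $D$ has no higher-order corrections in $\hbar$. Each $f\in C^\infty(M)[[\hbar]]$ has a unique $D$-flat lift $\sigma^{-1}(f)$ with $\sigma(\sigma^{-1}(f))=f$, where $\sigma$ is evaluation at $y=0$, and the star product is $f\star g=\sigma(\sigma^{-1}(f)\circ\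sigma^{-1}(g))$.
   Formalization: The formal parameter is rescaled: the sum of (iħ/4)^n RC_n, not of ħ^n RC_n, is shown identical to Fedosov's star product; with the stated normalizations the order-ħ terms differ (x1, x2 give 2ħ versus iħ/2). *)

(* Defs.v *)
From mathcomp Require Import all_boot all_order all_algebra.
From mathcomp Require Import complex.
From mathcomp Require Import all_classical all_reals all_analysis.

Set Implicit Arguments.
Unset Strict Implicit.
Unset Printing Implicit Defensive.

Import Order.TTheory GRing.Theory Num.Theory.
Import numFieldNormedType.Exports.

Local Open Scope classical_set_scope.
Local Open Scope ring_scope.
Local Open Scope complex_scope.

(** Everything is done in one global chart.  Functions are total on the
    coordinate space 'rV_d, and only their values on the open set [U] (the
    manifold) matter: every condition below is imposed on [U] only. *)

Section Smooth.
Variables (R : realType) (d : nat).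

Definition rpartial (i : 'I_d) (u : 'rV[R]_d -> R) : 'rV[R]_d -> R :=
  fun x => 'D_(delta_mx 0 i) u x.

Definition rsmooth (U : set 'rV[R]_d) (u : 'rV[R]_d -> R) : Prop :=
  forall (s : seq 'I_d) (x : 'rV[R]_d), U x ->
    {for x, continuous (foldr rpartial u s)} /\
    forall i, derivable (foldr rpartial u s) x (delta_mx 0 i).

(** R[i] carries no norm over [R] in the library, so complex-valued functions
    are differentiated through their real and imaginary parts. *)
Definition partial (i : 'I_d) (f : 'rV[R]_d -> R[i]) : 'rV[R]_d -> R[i] :=
  fun x => rpartial i (fun z => complex.Re (f z)) x +i*
           rpartial i (fun z => complex.Im (f z)) x.

Definition smooth (U : set 'rV[R]_d) (f : 'rV[R]_d -> R[i]) : Prop :=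
  rsmooth U (fun z => complex.Re (f z)) /\
  rsmooth U (fun z => complex.Im (f z)).

End Smooth.

(** [f k] is the coefficient of hbar^k. *)
Definition hseries (R : realType) (d : nat) := nat -> 'rV[R]_d -> R[i].

Section Fedosov.
Variables (R : realType) (d : nat).

Notation multi_index := {ffun 'I_d -> nat}.

(** Sections of the Weyl bundle: [a k al x] is the coefficient of
    hbar^k y^al at the point [x]. *)
Definition weyl := nat -> multi_index -> 'rV[R]_d -> R[i].

(** The coefficient of hbar^k y^al z^be. *)
Definition weyl2 := nat -> multi_index -> multi_index -> 'rV[R]_d -> R[i].

Definition mi0 : multi_index := [ffun=> 0%N].
Definition mi_incr (al : multi_index) (i : 'I_d) : multi_index :=
  [ffun j => (al j + (j == i))%N].
Definition mi_decr (al : multi_index) (i : 'I_d) : multi_index :=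
  [ffun j => (al j - (j == i))%N].
Definition mi_deg (al : multi_index) : nat := (\sum_j al j)%N.

Definition weyl_smooth (U : set 'rV[R]_d) (a : weyl) : Prop :=
  forall k al, smooth U (a k al).

Definition dy (i : 'I_d) (a : weyl) : weyl :=
  fun k al x => (al i).+1%:R * a k (mi_incr al i) x.

Definition ymul (i : 'I_d) (a : weyl) : weyl :=
  fun k al x => if al i == 0%N then 0 else a k (mi_decr al i) x.

(** [om x i j] is omega_ij, where omega = 1/2 omega_ij dx^i /\ dx^j; the
    coefficients omega^ij of the product are those of the inverse matrix. *)
Variable om : 'rV[R]_d -> 'M[R]_d.

(** [nabla x i j] is the vector nabla_{d_i} d_j at [x]. *)
Variable nabla : 'rV[R]_d -> 'I_d -> 'I_d -> 'rV[R]_d.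

Definition christoffel (k i j : 'I_d) (x : 'rV[R]_d) : R := nabla x i j 0 k.

Definition tensor (a b : weyl) : weyl2 := fun k al be x =>
  \sum_(p < k.+1) a p al x * b (k - p)%N be x.

(** omega^ij (d/dy^i) (d/dz^j) *)
Definition poisson_yz (c : weyl2) : weyl2 := fun k al be x =>
  \sum_i \sum_j (invmx (om x) i j)%:C *
     ((al i).+1%:R * (be j).+1%:R * c k (mi_incr al i) (mi_incr be j) x).

(** The sum over [al] with al j <= ga j for all j is the sum over the
    decompositions ga = al + be, that is, the restriction to z = y. *)
Definition weyl_mul (a b : weyl) : weyl := fun k ga x =>
  \sum_(n < k.+1) (- 'i%C / 2%:R) ^+ n / (n`!)%:R *
    \sum_(al : {dffun forall j : 'I_d, 'I_(ga j).+1})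
      iter n poisson_yz (tensor a b) (k - n)%N
        [ffun j => al j : nat] [ffun j => (ga j - al j)%N] x.

(** (i / hbar) [a, b]: the commutator has no term of order 0 in hbar, so the
    division is a shift of the index. *)
Definition weyl_ad (a b : weyl) : weyl := fun k al x =>
  'i%C * (weyl_mul a b k.+1 al x - weyl_mul b a k.+1 al x).

(** The dx^i component of the covariant derivative of a section. *)
Definition cov (i : 'I_d) (a : weyl) : weyl := fun k al x =>
  partial i (a k al) x
  - \sum_p \sum_j (christoffel p i j x)%:C * ymul j (dy p a) k al x.

(** W-valued 1-forms sum_i r_i dx^i; a 2-form sum_(i<j) c_ij dx^i /\ dx^j is
    given by its antisymmetric components c_ij. *)
Definition weyl1 := 'I_d -> weyl.

(** The dx^i component of D a = - delta a + partial a + (i / hbar) [r, a]. *)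
Definition Dconn (r : weyl1) (i : 'I_d) (a : weyl) : weyl := fun k al x =>
  - dy i a k al x + cov i a k al x + weyl_ad (r i) a k al x.

(** On a W-valued 1-form the dx^i /\ dx^j component of D eta is
    D_i eta_j - D_j eta_i, hence that of D (D a) is [D_i, D_j] a. *)
Definition Dconn_sq (r : weyl1) (i j : 'I_d) (a : weyl) : weyl := fun k al x =>
  Dconn r i (Dconn r j a) k al x - Dconn r j (Dconn r i a) k al x.

(** delta^{-1} on 1-forms, y^j iota(d_j) / (p + q) in y-degree p and
    form-degree q = 1; the result has y-degree |al| = p + 1. *)
Definition delta_inv (r : weyl1) : weyl := fun k al x =>
  (mi_deg al)%:R^-1 * \sum_j ymul j (r j) k al x.

(** R(d_i, d_j) d_l = sum_m riemann m l i j d_m *)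
Definition riemann (m l i j : 'I_d) (x : 'rV[R]_d) : R :=
  rpartial i (christoffel m j l) x - rpartial j (christoffel m i l) x
  + \sum_p (christoffel m i p x * christoffel p j l x
            - christoffel m j p x * christoffel p i l x).

Definition weyl_cst (u : 'rV[R]_d -> R) : weyl := fun k al x =>
  if (k == 0%N) && (al == mi0) then (u x)%:C else 0.

(** The dx^i /\ dx^j component of 1/4 R_{plij} y^p y^l dx^i /\ dx^j, with
    R_{plij} = omega_pm R^m_lij. *)
Definition curv_form (i j : 'I_d) : weyl := fun k al x =>
  \sum_p \sum_l ymul p (ymul l (weyl_cst (fun z =>
     2%:R^-1 * \sum_m om z p m * riemann m l i j z))) k al x.

(** Fedosov's Weyl curvature, the 2-form
      Omega = - omega + R - delta r + partial r + (i / hbar) r o r,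
    for which D^2 = (i / hbar) [Omega, .]; (i / hbar) Omega is the
    characteristic form of D.  The components of r o r are [r_i, r_j], and the
    torsion-free nabla does not contribute on the form indices. *)
Definition weyl_curvature (r : weyl1) (i j : 'I_d) : weyl := fun k al x =>
  - weyl_cst (fun z => om z i j) k al x + curv_form i j k al x
  - (dy i (r j) k al x - dy j (r i) k al x)
  + (cov i (r j) k al x - cov j (r i) k al x)
  + weyl_ad (r i) (r j) k al x.

(** Fedosov's 1-form: his normalisations are delta^{-1} r = 0 and deg r >= 3,
    where deg y = 1 and deg hbar = 2.  Since (i / hbar) (- omega) =
    omega / (i hbar), the curvature condition says that the characteristic form
    is omega / (i hbar). *)
Definition is_fedosov_form (U : set 'rV[R]_d) (r : weyl1) : Prop :=
  [/\ forall i, weyl_smooth U (r i),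
      forall i k al x, U x -> (k.*2 + mi_deg al < 3)%N -> r i k al x = 0,
      forall k al x, U x -> delta_inv r k al x = 0,
      forall i j k al x, U x ->
        weyl_curvature r i j k al x = - weyl_cst (fun z => om z i j) k al x
    & forall a, weyl_smooth U a ->
        forall i j k al x, U x -> Dconn_sq r i j a k al x = 0].

(** Evaluation at y = 0. *)
Definition symbol (a : weyl) : hseries R d := fun k x => a k mi0 x.

Definition is_flat_lift (U : set 'rV[R]_d) (r : weyl1) (f : hseries R d)
    (F : weyl) : Prop :=
  [/\ weyl_smooth U F,
      forall i k al x, U x -> Dconn r i F k al x = 0
    & forall k x, U x -> symbol F k x = f k x].

(** [h] is the Fedosov star product of [f] and [g]. *)
Definition is_fedosov_star (U : set 'rV[R]_d) (f g h : hseries R d) : Prop :=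
  exists (r : weyl1) (F G : weyl),
    [/\ is_fedosov_form U r, is_flat_lift U r f F, is_flat_lift U r g G
      & forall k x, U x -> h k x = symbol (weyl_mul F G) k x].

End Fedosov.

Section RankinCohen.
Variables (R : realType) (d : nat).
Variables X Y : ('rV[R]_d -> R[i]) -> ('rV[R]_d -> R[i]).

(** (2Y + c)_m *)
Fixpoint poch (c m : nat) (a : 'rV[R]_d -> R[i]) : 'rV[R]_d -> R[i] :=
  if m is m'.+1 then
    fun x => 2%:R * Y (poch c m' a) x + (c + m')%:R * poch c m' a x
  else a.

Definition rankin_cohen (n : nat) (a b : 'rV[R]_d -> R[i]) :
    'rV[R]_d -> R[i] := fun x =>
  \sum_(k < n.+1)
    ((-1) ^+ k / (k`!)%:R * iter k X (poch k (n - k) a) x) *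
    (((n - k)`!)%:R^-1 * iter (n - k) X (poch (n - k) k b) x).

(** The C[[hbar]]-bilinear extension of sum_n (c hbar)^n RC_n.  The scale [c]
    is needed to compare with Fedosov's product, whose formal parameter is
    normalised differently: on (R x R+, dx_1 /\ dx_2), with
    {a, b} = d_1 a d_2 b - d_2 a d_1 b, one has RC_1 (a, b) = 2 {a, b}, whereas
    a * b = a b + (i hbar / 2) {a, b} + O(hbar^2) for Fedosov's product. *)
Definition rc_star (c : R[i]) (f g : hseries R d) : hseries R d := fun k x =>
  \sum_(n < k.+1) c ^+ n *
    \sum_(p < (k - n).+1) rankin_cohen n (f p) (g (k - n - p)%N) x.

End RankinCohen.

Section HalfPlane.
Variable R : realType.

(** (x_1, x_2) is (x 0 i1, x 0 i2). *)
Definition i1 : 'I_2 := @Ordinal 2 0 isT.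
Definition i2 : 'I_2 := @Ordinal 2 1 isT.

Definition half_plane : set 'rV[R]_2 := [set x | 0 < x 0 i2].

(** dx_1 /\ dx_2 *)
Definition hp_omega (x : 'rV[R]_2) : 'M[R]_2 :=
  delta_mx i1 i2 - delta_mx i2 i1.

Definition hp_nabla (x : 'rV[R]_2) (i j : 'I_2) : 'rV[R]_2 :=
  if (i == i1) && (j == i1) then 0
  else if (i == i2) && (j == i2) then - (2%:R * x 0 i2)^-1 *: delta_mx 0 i2
  else (2%:R * x 0 i2)^-1 *: delta_mx 0 i1.

Definition hp_X (a : 'rV[R]_2 -> R[i]) : 'rV[R]_2 -> R[i] :=
  fun x => ((x 0 i2)^-1)%:C * partial i1 a x.

Definition hp_Y (a : 'rV[R]_2 -> R[i]) : 'rV[R]_2 -> R[i] :=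
  fun x => - (x 0 i2)%:C * partial i2 a x.

End HalfPlane.

(* Main.v *)
Require Import Defs.
From mathcomp Require Import all_boot all_order all_algebra.
From mathcomp Require Import complex.
From mathcomp Require Import all_classical all_reals all_analysis.
From mathcomp Require Import ring lra zify.

(** The connection is flat: the Riemann tensor vanishes and u = x1 sqrt x2,
    v = 2 sqrt x2 are affine symplectic coordinates.  Hence r = 0 is a Fedosov
    form with the prescribed characteristic form, and by induction on the total
    degree (Hodge decomposition of delta) it is the only one.  The D-flat lift of
    f is then its Taylor expansion along the connection, and Fedosov's product is
    the Moyal product of these expansions.  On the other side -2Y is the Euler
    field of the flat coordinates and X is proportional to d_1, so that
    X^k (2Y+k)_m f is, up to the factor x2^(-k) (-2 x2)^m, the iterated covariant
    derivative of f, k times along d_1 and m times along d_2: the n-th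
    Rankin-Cohen bracket is the n-th transvectant, term by term. *)

Set Implicit Arguments.
Unset Strict Implicit.
Unset Printing Implicit Defensive.

Import Order.TTheory GRing.Theory Num.Theory.
Import numFieldNormedType.Exports.

Local Open Scope classical_set_scope.
Local Open Scope ring_scope.
Local Open Scope complex_scope.

(** * Iterated partial derivatives of real functions *)

Section RealSmooth.
Variables (R : realType) (d : nat) (U : set 'rV[R]_d).
Hypothesis openU : open U.
Implicit Types (u v : 'rV[R]_d -> R) (i j : 'I_d).

(** One layer of [rsmooth]: just enough regularity on [U] for the sum, product and quotient rules
    and for the mean value theorem. *)
Definition pdiff u : Prop := forall x, U x ->
  {for x, continuous u} /\ forall i, derivable u x (delta_mx 0 i).

(** In [rsmooth] the recursion adds the outermost derivative. Here it peels off the derivative taken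
    first, so that an induction on [n] can apply the Leibniz rule to [u] itself. *)
Fixpoint smooth_upto (n : nat) u : Prop :=
  pdiff u /\ if n is n'.+1 then forall i, smooth_upto n' (rpartial i u) else True.

Lemma smooth_upto_pdiff n u : smooth_upto n u -> pdiff u.
Proof. by case: n => [|n] []. Qed.

Lemma rsmoothP u : rsmooth U u <-> forall n, smooth_upto n u.
Proof.
split=> [su n|su s x Ux].
  elim: n u su => [|n IHn] u su; split=> //; try by move=> x /(su [::]).
  by move=> i; apply: IHn => s x Ux; have := su (rcons s i) x Ux; rewrite foldr_rcons.
have {}su : smooth_upto (size s) u by [].
elim/last_ind: s u su => [|s i IHs] u /=; first by case=> + _; apply.
rewrite size_rcons foldr_rcons => -[_ su]; exact: (IHs _ (su i)).
Qed.

Lemma near_open x : U x -> \forall y \near x, U y.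
Proof. by move=> Ux; exact: open_nbhs_nbhs. Qed.

(** Openness of [U] is what lets an equality known only on [U] pass to limits and derivatives at the
    points of [U]. *)
Lemma near_eq_in u v x : {in U, u =1 v} -> U x -> \forall y \near x, u y = v y.
Proof.
move=> uv Ux; near=> y; apply: uv; rewrite inE.
by near: y; apply: near_open.
Unshelve. all: by end_near. Qed.

Lemma rpartial_ext i u v x : {in U, u =1 v} -> U x ->
  rpartial i u x = rpartial i v x.
Proof. by move=> uv Ux; apply: near_eq_derive; apply: near_eq_in. Qed.

Lemma pdiff_ext u v : {in U, u =1 v} -> pdiff u -> pdiff v.
Proof.
move=> uv su x Ux; have [cu du] := su x Ux; have nuv := near_eq_in uv Ux.
split=> [|i]; last exact: near_eq_derivable (du i).
suff : v @ x --> v x by [].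
rewrite -uv ?inE//; apply: cvg_trans cu.
exact: near_eq_cvg nuv.
Unshelve. all: by end_near. Qed.

Lemma smooth_upto_ext n u v : {in U, u =1 v} -> smooth_upto n u ->
  smooth_upto n v.
Proof.
elim: n u v => [|n IHn] u v uv [su dsu];
  (split; first exact: pdiff_ext uv su); first exact: I.
move=> i; apply: IHn (dsu i) => x; rewrite inE => Ux.
exact: rpartial_ext.
Qed.

Lemma smooth_uptoS n u : smooth_upto n.+1 u -> smooth_upto n u.
Proof.
by elim: n u => [|n IHn] u [su dsu]; split=> // i; apply: IHn.
Qed.

Lemma pdiffD u v : pdiff u -> pdiff v -> pdiff (fun x => u x + v x).
Proof.
move=> su sv x Ux; have [cu du] := su x Ux; have [cv dv] := sv x Ux.
by split=> [|i]; [exact: continuousD|exact: derivableD].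
Qed.

Lemma pdiffM u v : pdiff u -> pdiff v -> pdiff (fun x => u x * v x).
Proof.
move=> su sv x Ux; have [cu du] := su x Ux; have [cv dv] := sv x Ux.
by split=> [|i]; [exact: continuousM|exact: derivableM].
Qed.

Lemma pdiffV u : {in U, forall x, u x != 0} -> pdiff u ->
  pdiff (fun x => (u x)^-1).
Proof.
move=> u0 su x Ux; have [cu du] := su x Ux; have ux0 : u x != 0 by rewrite u0 ?inE.
by split=> [|i]; [exact: continuousV|exact: derivableV].
Qed.

Lemma rpartialD i u v x : pdiff u -> pdiff v -> U x ->
  rpartial i (fun x => u x + v x) x = rpartial i u x + rpartial i v x.
Proof.
by move=> su sv Ux; have [_ du] := su x Ux; have [_ dv] := sv x Ux; exact: deriveD.
Qed.

Lemma rpartialM i u v x : pdiff u -> pdiff v -> U x ->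
  rpartial i (fun x => u x * v x) x = u x * rpartial i v x + v x * rpartial i u x.
Proof.
by move=> su sv Ux; have [_ du] := su x Ux; have [_ dv] := sv x Ux; exact: deriveM.
Qed.

Lemma rpartialV i u x : u x != 0 -> pdiff u -> U x ->
  rpartial i (fun x => (u x)^-1) x = - ((u x)^-1 * (u x)^-1) * rpartial i u x.
Proof.
move=> u0 su Ux; have [_ du] := su x Ux; rewrite -invfM -expr2; exact: deriveV.
Qed.

Lemma rpartial_cst i c x : rpartial i (fun=> c) x = 0 :> R.
Proof. exact: derive_cst. Qed.

Lemma smooth_uptoD n u v : smooth_upto n u -> smooth_upto n v ->
  smooth_upto n (fun x => u x + v x).
Proof.
elim: n u v => [|n IHn] u v su sv; (split;
  first by apply: pdiffD; apply: smooth_upto_pdiff; eassumption) => //= i.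
apply: (smooth_upto_ext (u := fun x => rpartial i u x + rpartial i v x)).
  move=> x; rewrite inE => Ux.
  by rewrite rpartialD//; [exact: smooth_upto_pdiff su|exact: smooth_upto_pdiff sv].
by apply: IHn; [exact: (proj2 su)|exact: (proj2 sv)].
Qed.

Lemma smooth_uptoM n u v : smooth_upto n u -> smooth_upto n v ->
  smooth_upto n (fun x => u x * v x).
Proof.
elim: n u v => [|n IHn] u v su sv; (split;
  first by apply: pdiffM; apply: smooth_upto_pdiff; eassumption) => //= i.
apply: (smooth_upto_ext (u := fun x => u x * rpartial i v x + v x * rpartial i u x)).
  move=> x; rewrite inE => Ux.
  by rewrite rpartialM//; [exact: smooth_upto_pdiff su|exact: smooth_upto_pdiff sv].
by apply: smooth_uptoD; apply: IHn;
  [exact: smooth_uptoS|exact: (proj2 sv)|exact: smooth_uptoS|exact: (proj2 su)].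
Qed.

Lemma smooth_upto_cst n c : smooth_upto n (fun=> c).
Proof.
have dc c' : pdiff (fun=> c').
  by move=> x _; split=> [|i]; [exact: cst_continuous|exact: derivable_cst].
elim: n c => [|n IHn] c; split=> // i.
apply: (smooth_upto_ext (u := fun=> 0)); last exact: IHn.
by move=> x _; rewrite rpartial_cst.
Qed.

Lemma smooth_uptoV n u : {in U, forall x, u x != 0} -> smooth_upto n u ->
  smooth_upto n (fun x => (u x)^-1).
Proof.
move=> u0; elim: n => [|n IHn] su; (split;
  first by apply: pdiffV => //; apply: smooth_upto_pdiff su) => //= i.
apply: (smooth_upto_ext (u := fun x => (-1) * ((u x)^-1 * (u x)^-1) * rpartial i u x)).
  move=> x; rewrite inE => Ux; rewrite rpartialV ?u0 ?inE ?mulN1r//.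
  exact: smooth_upto_pdiff su.
have sV := IHn (smooth_uptoS su).
apply: smooth_uptoM; last exact: (proj2 su).
by do 2?apply: smooth_uptoM => //; exact: smooth_upto_cst.
Qed.

Lemma is_derive_coord i (x w : 'rV[R]_d) :
  is_derive x w (fun y : 'rV[R]_d => y 0 i : R) (w 0 i).
Proof.
apply: DeriveDef; first exact/diff_derivable/differentiable_coord.
rewrite /derive; apply: cvg_lim => //.
apply: cvg_near_cst; near=> h.
have h0 : h != 0 by near: h; apply: nbhs_dnbhs_neq.
by rewrite /= !mxE addrK [LHS]mulrA mulVf// mul1r.
Unshelve. all: by end_near. Qed.

Lemma rpartial_coord i j (x : 'rV[R]_d) :
  rpartial j (fun x => x 0 i) x = (i == j)%:R.
Proof.
by have dc := is_derive_coord i x (delta_mx 0 j); rewrite /rpartial derive_val mxE eqxx.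
Qed.

Lemma pdiff_coord i : pdiff (fun x => x 0 i).
Proof.
move=> x Ux; split=> [|j]; first exact: coord_continuous.
by case: (is_derive_coord i x (delta_mx 0 j)).
Qed.

Lemma smooth_upto_coord n i : smooth_upto n (fun x => x 0 i).
Proof.
case: n => [|n]; (split; first exact: pdiff_coord) => //= j.
apply: (smooth_upto_ext (u := fun=> (i == j)%:R)); last exact: smooth_upto_cst.
by move=> x _; rewrite rpartial_coord.
Qed.

(** * Symmetry of second derivatives *)

Lemma is_derive_translate u (w x v : 'rV[R]_d) : derivable u (x + w) v ->
  is_derive x v (fun z => u (z + w)) ('D_v u (x + w)).
Proof.
have E : (fun h : R => h^-1 *: (((fun z => u (z + w)) \o shift x) (h *: v) - u (x + w)))
    = (fun h => h^-1 *: ((u \o shift (x + w)) (h *: v) - u (x + w))).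
  by apply/funext => h /=; rewrite addrA.
by move=> du; apply: DeriveDef; rewrite /derivable /derive E.
Qed.

(** The one-variable mean value theorem along the segment from [x] in the [i]-th coordinate
    direction. *)
Lemma MVT_rpartial i u x h : 0 < h ->
    (forall t, 0 <= t <= h -> derivable u (x + t *: delta_mx 0 i) (delta_mx 0 i)) ->
  exists2 t, 0 <= t <= h &
    u (x + h *: delta_mx 0 i) - u x = h * rpartial i u (x + t *: delta_mx 0 i).
Proof.
move=> h0 du; pose e : 'rV[R]_d := delta_mx 0 i.
pose phi (t : R) := u (x + t *: e).
have dphi t : 0 <= t <= h -> is_derive t 1 phi (rpartial i u (x + t *: e)).
  move=> /du dut.
  (* The difference quotient of [phi] at [t] is that of [u] at [x + t *: e] in the direction [e]. *)
  have E : (fun k : R => k^-1 *: ((phi \o shift t) (k *: 1) - phi t)) =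
           (fun k => k^-1 *: ((u \o shift (x + t *: e)) (k *: e) - u (x + t *: e))).
    apply/funext => k /=; rewrite /phi [k *: 1]mulr1 scalerDl.
    by rewrite addrCA.
  by apply: DeriveDef; rewrite /derivable /derive E.
have [||t t0h] := MVT (f := phi) (df := fun t => rpartial i u (x + t *: e)) h0.
- by move=> t; rewrite in_itv/= => /andP[/ltW t0 /ltW th]; apply: dphi; rewrite t0.
- apply: derivable_within_continuous => t; rewrite in_itv/= => /dphi.
  by case.
- rewrite /phi scale0r addr0 subr0 mulrC => ->; exists t => //.
  by move: t0h; rewrite in_itv/= => /andP[/ltW -> /ltW ->].
Qed.

(** The second difference is symmetric in i and j, whence Schwarz's theorem below. *)
Lemma second_difference i j u x h : 0 < h -> pdiff u -> pdiff (rpartial i u) ->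
    (forall s t, 0 <= s <= h -> 0 <= t <= h ->
       U (x + s *: delta_mx 0 i + t *: delta_mx 0 j)) ->
  exists s t, [/\ 0 <= s <= h, 0 <= t <= h &
    u (x + h *: delta_mx 0 i + h *: delta_mx 0 j) - u (x + h *: delta_mx 0 i)
      - (u (x + h *: delta_mx 0 j) - u x)
    = h * (h * rpartial j (rpartial i u) (x + s *: delta_mx 0 i + t *: delta_mx 0 j))].
Proof.
move=> h0 su siu Uh.
have hh : 0 <= h <= h by rewrite ltW//=.
have h00 : 0 <= (0 : R) <= h by rewrite lexx ltW.
have dphi s : 0 <= s <= h -> is_derive (x + s *: delta_mx 0 i) (delta_mx 0 i)
    ((fun z => u (z + h *: delta_mx 0 j)) - u)
    (rpartial i u (x + s *: delta_mx 0 i + h *: delta_mx 0 j)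
      - rpartial i u (x + s *: delta_mx 0 i)).
  move=> sh; have [_ d1] := su _ (Uh _ _ sh hh).
  have [_] := su _ (Uh _ _ sh h00); rewrite scale0r addr0 => d2.
  apply: is_deriveB; first exact: is_derive_translate.
  by apply: DeriveDef.
(* The mean value theorem is applied twice: in direction [i] to the increment of [u] by [h] along
   [j], then in direction [j] to [rpartial i u]. *)
have [|s sh E] := MVT_rpartial (i := i) (u := (fun z => u (z + h *: delta_mx 0 j)) - u)
  (x := x) h0.
  by move=> s /dphi [].
have [_ Es] := dphi s sh; rewrite {1}/rpartial Es in E.
have [|t th Et] := MVT_rpartial (i := j) (u := rpartial i u) (x := x + s *: delta_mx 0 i) h0.
  by move=> t th; exact: (proj2 (siu _ (Uh _ _ sh th)) j).
by exists s, t; split=> //; rewrite -Et -E.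
Qed.

(** Both [f x] and [g x] lie within [eps / 2] of a common value [f y = g z], for every [eps]. *)
Lemma continuous_close_eq (f g : 'rV[R]_d -> R) x :
    {for x, continuous f} -> {for x, continuous g} ->
    (\forall r \near 0^'+, exists y z, [/\ ball x r y, ball x r z & f y = g z]) ->
  f x = g x.
Proof.
move=> cf cg fg; apply/eqP; rewrite -subr_eq0 -normr_le0.
apply/ler_addgt0Pl => eps eps0; rewrite addr0.
have e2 : 0 < eps / 2 by rewrite divr_gt0.
have near_eps (v : 'rV[R]_d -> R) : {for x, continuous v} ->
    exists2 r, 0 < r & forall y, ball x r y -> `|v x - v y| < eps / 2.
  move=> cv; have nv : \forall y \near x, `|v x - v y| < eps / 2.
    exact: (cvgr_dist_lt _ _ cv _ e2).
  by have [r r0 xr] := (nbhs_ballP _ _).1 nv; exists r.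
have [r1 r10 fr] := near_eps f cf; have [r2 r20 gr] := near_eps g cg.
have : \forall r \near 0^'+, [/\ r <= r1, r <= r2 &
    exists y z, [/\ ball x r y, ball x r z & f y = g z]].
  near=> r; split; near: r; [exact: nbhs_right_le|exact: nbhs_right_le|exact: fg].
move=> /(@filter_ex _ _ (at_right_proper_filter 0))[r [rr1 rr2 [y [z [xy xz E]]]]].
have D1 := fr y (le_ball rr1 xy); have D2 := gr z (le_ball rr2 xz).
have -> : f x - g x = (f x - f y) - (g x - g z) by rewrite E; ring.
rewrite (splitr eps); apply: (le_trans (ler_normB _ _)); apply: lerD; exact: ltW.
Unshelve. all: by end_near. Qed.

(** The second difference over a small square, divided by its squared side, is a value near [x] of
    either mixed derivative; continuity of both then gives equality at [x]. *)
Lemma rpartialC i j u x : smooth_upto 2 u -> U x ->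
  rpartial i (rpartial j u) x = rpartial j (rpartial i u) x.
Proof.
move=> [su dsu] Ux.
have [ca _] := proj1 (proj2 (dsu j) i) x Ux.
have [cb _] := proj1 (proj2 (dsu i) j) x Ux.
apply: (continuous_close_eq ca cb).
have [r0 r00 xr0] := (nbhs_ballP _ _).1 (near_open Ux).
near=> r; have rr0 : 0 < r by near: r; exact: nbhs_right_gt.
have ler0 : r <= r0 by near: r; exact: nbhs_right_le.
pose M := `|delta_mx 0 i : 'rV[R]_d| + `|delta_mx 0 j : 'rV[R]_d| + 1.
have M0 : 0 < M by rewrite ltr_wpDl ?addr_ge0.
(* With this side, [h * M = r / 2], so the whole square stays in the ball of radius [r]. *)
pose h := r / (M * 2); have h0 : 0 < h by rewrite divr_gt0 ?mulr_gt0.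
have near_x s t : 0 <= s <= h -> 0 <= t <= h ->
    ball x r (x + s *: delta_mx 0 i + t *: delta_mx 0 j).
  move=> /andP[s0 sh] /andP[t0 th]; rewrite -ball_normE /ball_/= -addrA opprD addNKr normrN.
  apply: (le_lt_trans (ler_normD _ _)); rewrite !normrZ !ger0_norm//.
  apply: (@le_lt_trans _ _ (h * M)).
    rewrite /M !mulrDr mulr1; apply: ler_wpDr; first exact: ltW.
    by apply: lerD; apply: ler_wpM2r.
  have -> : h * M = r / 2 by rewrite /h; field; rewrite lt0r_neq0.
  lra.
have Uh s t : 0 <= s <= h -> 0 <= t <= h ->
    U (x + s *: delta_mx 0 i + t *: delta_mx 0 j).
  by move=> sh th; apply: xr0; apply: (le_ball ler0); exact: near_x.
have Uh' t s : 0 <= t <= h -> 0 <= s <= h ->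
    U (x + t *: delta_mx 0 j + s *: delta_mx 0 i).
  by move=> th sh; rewrite addrAC; apply: Uh.
have [s1 [t1 [s1h t1h E1]]] := second_difference h0 su (proj1 (dsu i)) Uh.
have [t2 [s2 [t2h s2h E2]]] := second_difference h0 su (proj1 (dsu j)) Uh'.
exists (x + t2 *: delta_mx 0 j + s2 *: delta_mx 0 i),
  (x + s1 *: delta_mx 0 i + t1 *: delta_mx 0 j).
split; [by rewrite addrAC; exact: near_x|exact: near_x|].
apply: (mulfI (lt0r_neq0 h0)); apply: (mulfI (lt0r_neq0 h0)).
apply: (etrans (esym E2)); apply: (etrans _ E1).
by rewrite (addrAC x); ring.
Unshelve. all: by end_near. Qed.

End RealSmooth.

(** * Complex-valued smooth functions *)

Section ComplexSmooth.
Variables (R : realType) (d : nat) (U : set 'rV[R]_d).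
Hypothesis openU : open U.
Implicit Types (f g : 'rV[R]_d -> R[i]) (i j : 'I_d).

Lemma rsmooth_pdiff u : rsmooth U u -> pdiff U u.
Proof. by move=> /rsmoothP su; apply: smooth_upto_pdiff (su 0%N). Qed.

Lemma rsmooth_ext u v : {in U, u =1 v} -> rsmooth U u -> rsmooth U v.
Proof.
move=> uv /rsmoothP su; apply/rsmoothP => n.
exact: smooth_upto_ext uv (su n).
Qed.

Lemma rsmoothD u v : rsmooth U u -> rsmooth U v -> rsmooth U (fun x => u x + v x).
Proof. by move=> /rsmoothP su /rsmoothP sv; apply/rsmoothP => n; apply: smooth_uptoD. Qed.

Lemma rsmoothM u v : rsmooth U u -> rsmooth U v -> rsmooth U (fun x => u x * v x).
Proof. by move=> /rsmoothP su /rsmoothP sv; apply/rsmoothP => n; apply: smooth_uptoM. Qed.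

Lemma rsmooth_cst c : rsmooth U (fun=> c).
Proof. by apply/rsmoothP => n; apply: smooth_upto_cst. Qed.

Lemma rsmoothN u : rsmooth U u -> rsmooth U (fun x => - u x).
Proof.
move=> su; apply: rsmooth_ext (rsmoothM (rsmooth_cst (-1)) su) => x _.
by rewrite mulN1r.
Qed.

Lemma rsmoothV u : {in U, forall x, u x != 0} -> rsmooth U u ->
  rsmooth U (fun x => (u x)^-1).
Proof. by move=> u0 /rsmoothP su; apply/rsmoothP => n; apply: smooth_uptoV. Qed.

Lemma rsmooth_coord i : rsmooth U (fun x => x 0 i).
Proof. by apply/rsmoothP => n; apply: smooth_upto_coord. Qed.

Lemma rsmooth_rpartial i u : rsmooth U u -> rsmooth U (rpartial i u).
Proof. by move=> /rsmoothP su; apply/rsmoothP => n; apply: (proj2 (su n.+1)). Qed.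

Lemma rpartialN i u x : rsmooth U u -> U x ->
  rpartial i (fun x => - u x) x = - rpartial i u x.
Proof.
move=> su Ux; have E : {in U, (fun x => - u x) =1 (fun x => -1 * u x)}.
  by move=> y _; rewrite mulN1r.
rewrite (rpartial_ext openU i E Ux).
rewrite (rpartialM i (rsmooth_pdiff (rsmooth_cst (-1))) (rsmooth_pdiff su) Ux).
by rewrite rpartial_cst mulr0 addr0 mulN1r.
Qed.

Lemma complex_eq (a b : R[i]) : complex.Re a = complex.Re b ->
  complex.Im a = complex.Im b -> a = b.
Proof. by case: a b => [a1 a2] [b1 b2] /= -> ->. Qed.

Lemma ReD (a b : R[i]) : complex.Re (a + b) = complex.Re a + complex.Re b.
Proof. by case: a b => [a1 a2] [b1 b2]. Qed.
Lemma ImD (a b : R[i]) : complex.Im (a + b) = complex.Im a + complex.Im b.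
Proof. by case: a b => [a1 a2] [b1 b2]. Qed.
Lemma ReM (a b : R[i]) : complex.Re (a * b) =
  complex.Re a * complex.Re b - complex.Im a * complex.Im b.
Proof. by case: a b => [a1 a2] [b1 b2]. Qed.
Lemma ImM (a b : R[i]) : complex.Im (a * b) =
  complex.Re a * complex.Im b + complex.Im a * complex.Re b.
Proof. by case: a b => [a1 a2] [b1 b2]. Qed.

Lemma smooth_ext f g : {in U, f =1 g} -> smooth U f -> smooth U g.
Proof. by move=> fg [sr si]; split; [apply: rsmooth_ext sr|apply: rsmooth_ext si] => x /fg ->. Qed.

Lemma partial_ext i f g x : {in U, f =1 g} -> U x -> partial i f x = partial i g x.
Proof.
by move=> fg Ux; apply: complex_eq; rewrite /=; apply: (rpartial_ext openU _ _ Ux) => y /fg ->.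
Qed.

Lemma smoothD f g : smooth U f -> smooth U g -> smooth U (fun x => f x + g x).
Proof.
move=> [fr fi] [gr gi]; split.
  by apply: rsmooth_ext (rsmoothD fr gr) => x _; rewrite ReD.
by apply: rsmooth_ext (rsmoothD fi gi) => x _; rewrite ImD.
Qed.

Lemma smoothM f g : smooth U f -> smooth U g -> smooth U (fun x => f x * g x).
Proof.
move=> [fr fi] [gr gi]; split.
  apply: rsmooth_ext (rsmoothD (rsmoothM fr gr) (rsmoothN (rsmoothM fi gi))) => x _.
  by rewrite ReM.
by apply: rsmooth_ext (rsmoothD (rsmoothM fr gi) (rsmoothM fi gr)) => x _; rewrite ImM.
Qed.

Lemma smooth_cst c : smooth U (fun=> c).
Proof. by split; apply: rsmooth_cst. Qed.

Lemma smooth_real u : rsmooth U u -> smooth U (fun x => (u x)%:C).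
Proof. by move=> su; split; [exact: su|exact: rsmooth_cst]. Qed.

Lemma smooth_partial i f : smooth U f -> smooth U (partial i f).
Proof. by case=> fr fi; split; exact: rsmooth_rpartial. Qed.

Lemma partialD i f g x : smooth U f -> smooth U g -> U x ->
  partial i (fun x => f x + g x) x = partial i f x + partial i g x.
Proof.
move=> [fr fi] [gr gi] Ux; apply: complex_eq; rewrite /=.
  rewrite -(rpartialD i (rsmooth_pdiff fr) (rsmooth_pdiff gr) Ux).
  by apply: (rpartial_ext openU _ _ Ux) => y _; rewrite ReD.
rewrite -(rpartialD i (rsmooth_pdiff fi) (rsmooth_pdiff gi) Ux).
by apply: (rpartial_ext openU _ _ Ux) => y _; rewrite ImD.
Qed.

Lemma partialM i f g x : smooth U f -> smooth U g -> U x ->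
  partial i (fun x => f x * g x) x = f x * partial i g x + g x * partial i f x.
Proof.
move=> [fr fi] [gr gi] Ux; have pd := rsmooth_pdiff; apply: complex_eq.
  have E : {in U, (fun y => complex.Re (f y * g y)) =1 fun y =>
      complex.Re (f y) * complex.Re (g y) + - (complex.Im (f y) * complex.Im (g y))}.
    by move=> y _; rewrite ReM.
  have s1 := rsmoothM fr gr; have s2 := rsmoothM fi gi.
  rewrite ReD !ReM /= (rpartial_ext openU i E Ux).
  rewrite (rpartialD i (pd _ s1) (pd _ (rsmoothN s2)) Ux) (rpartialN i s2 Ux).
  rewrite (rpartialM i (pd _ fr) (pd _ gr) Ux) (rpartialM i (pd _ fi) (pd _ gi) Ux).
  by ring.
have E : {in U, (fun y => complex.Im (f y * g y)) =1 fun y =>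
    complex.Re (f y) * complex.Im (g y) + complex.Im (f y) * complex.Re (g y)}.
  by move=> y _; rewrite ImM.
rewrite ImD !ImM /= (rpartial_ext openU i E Ux).
rewrite (rpartialD i (pd _ (rsmoothM fr gi)) (pd _ (rsmoothM fi gr)) Ux).
rewrite (rpartialM i (pd _ fr) (pd _ gi) Ux) (rpartialM i (pd _ fi) (pd _ gr) Ux).
by ring.
Qed.

Lemma partial_cst i (c : R[i]) x : partial i (fun=> c) x = 0.
Proof. by rewrite /partial !rpartial_cst. Qed.

Lemma partial_real i (u : 'rV[R]_d -> R) x :
  partial i (fun x => (u x)%:C) x = (rpartial i u x)%:C.
Proof. by rewrite /partial /= rpartial_cst. Qed.

Lemma partialZ i c f x : smooth U f -> U x ->
  partial i (fun x => c * f x) x = c * partial i f x.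
Proof.
by move=> sf Ux; rewrite (partialM i (smooth_cst c) sf Ux) partial_cst mulr0 addr0.
Qed.

Lemma smoothZ c f : smooth U f -> smooth U (fun x => c * f x).
Proof. by apply: smoothM; exact: smooth_cst. Qed.

Lemma smoothN f : smooth U f -> smooth U (fun x => - f x).
Proof. by move=> /(smoothZ (-1)); apply: smooth_ext => x _; rewrite mulN1r. Qed.

Lemma smoothX f n : smooth U f -> smooth U (fun x => f x ^+ n).
Proof.
move=> sf; elim: n => [|n IHn]; first by apply: (smooth_ext _ (smooth_cst 1)) => x _.
by apply: (smooth_ext _ (smoothM sf IHn)) => x _; rewrite exprS.
Qed.

(** For [n = 0] the truncated exponent [n.-1] is harmless, since the factor [n%:R] vanishes. *)
Lemma partialX i f n x : smooth U f -> U x ->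
  partial i (fun x => f x ^+ n) x = n%:R * f x ^+ n.-1 * partial i f x.
Proof.
move=> sf Ux; elim: n => [|n IHn].
  by rewrite mulr0n !mul0r (partial_ext i (g := fun=> 1)) ?partial_cst//.
have E : {in U, (fun x => f x ^+ n.+1) =1 (fun x => f x * f x ^+ n)}.
  by move=> y _; rewrite exprS.
rewrite (partial_ext i E Ux) (partialM i sf (smoothX n sf) Ux) IHn.
case: n {IHn E} => [|n]; first by rewrite /= !expr0; ring.
by rewrite !succnK -!natr1 !exprS; ring.
Qed.

Lemma partialN i f x : smooth U f -> U x -> partial i (fun x => - f x) x = - partial i f x.
Proof.
move=> sf Ux; rewrite -mulN1r -(partialZ i _ sf Ux); apply: (partial_ext i _ Ux) => y _.
by rewrite mulN1r.
Qed.

Lemma partialC i j f x : smooth U f -> U x ->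
  partial i (partial j f) x = partial j (partial i f) x.
Proof.
move=> [/rsmoothP fr /rsmoothP fi] Ux.
by apply: complex_eq; apply: (rpartialC openU _ _ _ Ux).
Qed.

End ComplexSmooth.

(** * Covariant derivatives on the half-plane *)

Section HalfPlaneJets.
Variable R : realType.
Implicit Types f phi psi : 'rV[R]_2 -> R[i].

Local Notation U := (half_plane (R := R)).
Local Notation d1 := (partial (R := R) i1).
Local Notation d2 := (partial (R := R) i2).

Lemma half_plane_open : open U.
Proof.
have : continuous (fun x : 'rV[R]_2 => x 0 i2 : R) by move=> x; exact: coord_continuous.
by move=> /continuousP /(_ _ (@open_gt _ 0)).
Qed.

(** Up to sign the only function among the Christoffel symbols:
    $\Gamma^1_{12}=\Gamma^1_{21}=\gamma$, $\Gamma^2_{22}=-\gamma$, the others being 0. *)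
Definition gamma (x : 'rV[R]_2) : R := (2%:R * x 0 i2)^-1.

Let x2_neq0 : {in U, forall x : 'rV[R]_2, 2%:R * x 0 i2 != 0}.
Proof. by move=> x; rewrite inE => /lt0r_neq0 Ux; rewrite mulf_neq0// pnatr_eq0. Qed.

Lemma rsmooth_x2 : rsmooth U (fun x : 'rV[R]_2 => 2%:R * x 0 i2).
Proof.
apply: (rsmoothM half_plane_open); first exact: (rsmooth_cst half_plane_open).
exact: (rsmooth_coord half_plane_open).
Qed.

Lemma smooth_gamma : smooth U (fun x => (gamma x)%:C).
Proof.
apply: (smooth_real half_plane_open); apply: (rsmoothV half_plane_open x2_neq0).
exact: rsmooth_x2.
Qed.

(** The relation $\partial_2\gamma=-2\gamma^2$ is behind every cancellation that expresses flatness
    below. *)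
Lemma rpartial_gamma i x : U x ->
  rpartial i gamma x = - 2%:R * (i == i2)%:R * gamma x * gamma x.
Proof.
move=> Ux; rewrite (rpartialV (U := U)) ?x2_neq0 ?inE//; last exact: rsmooth_pdiff rsmooth_x2.
rewrite (rpartialM (U := U))//; last 2 first.
- by apply: rsmooth_pdiff; exact: (rsmooth_cst half_plane_open).
- by apply: rsmooth_pdiff; exact: (rsmooth_coord half_plane_open).
by rewrite rpartial_coord rpartial_cst eq_sym /gamma; ring.
Qed.

Lemma partial_gamma i x : U x ->
  partial i (fun x => (gamma x)%:C) x =
  - 2%:R * (i == i2)%:R * (gamma x)%:C * (gamma x)%:C.
Proof.
by move=> Ux; rewrite partial_real rpartial_gamma// !rmorphM rmorphN !rmorph_nat.
Qed.

(** If phi = (nabla^k f)(d_1, ..., d_1), then [jet2 k m phi] is the component of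
    nabla^(k+m) f on k copies of d_1 and m copies of d_2. *)
Fixpoint jet2 (k m : nat) phi : 'rV[R]_2 -> R[i] :=
  if m is m'.+1 then
    fun x => d2 (jet2 k m' phi) x - (k%:R - m'%:R) * (gamma x)%:C * jet2 k m' phi x
  else phi.

Lemma smooth_jet2 k m phi : smooth U phi -> smooth U (jet2 k m phi).
Proof.
move=> sphi; elim: m => [//|m IHm] /=; have oU := half_plane_open.
apply: (smoothD oU); first exact: smooth_partial.
exact: (smoothN oU (smoothM oU (smoothZ oU (k%:R - m%:R) smooth_gamma) IHm)).
Qed.

Lemma partial_jet2S i k m phi x : smooth U phi -> U x ->
  partial i (jet2 k m.+1 phi) x = partial i (d2 (jet2 k m phi)) x
    - (k%:R - m%:R) * ((gamma x)%:C * partial i (jet2 k m phi) x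
       - 2%:R * (i == i2)%:R * (gamma x)%:C * (gamma x)%:C * jet2 k m phi x).
Proof.
move=> sphi Ux; have oU := half_plane_open; have sg := smooth_gamma.
have sj := smooth_jet2 k m sphi.
have sgj := smoothM oU sg sj.
have E : {in U, jet2 k m.+1 phi =1
    fun x => d2 (jet2 k m phi) x + - (k%:R - m%:R) * ((gamma x)%:C * jet2 k m phi x)}.
  by move=> y _ /=; ring.
have sZ := smoothZ oU (- (k%:R - m%:R)) sgj.
rewrite (partial_ext oU i E Ux) (partialD oU i (smooth_partial i2 sj) sZ Ux).
rewrite (partialZ oU i _ sgj Ux) (partialM oU i sg sj Ux) (partial_gamma i Ux).
by ring.
Qed.

(** [gamma] does not depend on the first coordinate, and mixed partial derivatives commute. *)
Lemma partial1_jet2 k m phi x : smooth U phi -> U x ->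
  d1 (jet2 k m phi) x = jet2 k m (d1 phi) x.
Proof.
move=> sphi; have oU := half_plane_open; elim: m x => [//|m IHm] x Ux.
have E : {in U, d1 (jet2 k m phi) =1 jet2 k m (d1 phi)}.
  by move=> y; rewrite inE; apply: IHm.
rewrite (partial_jet2S i1 k m sphi Ux) (partialC oU i1 i2 (smooth_jet2 k m sphi) Ux).
by rewrite (partial_ext oU i2 E Ux) (IHm x Ux) /=; ring.
Qed.

(** Raising [k] by one subtracts one more [gamma] at each of the [m] steps;
    $\partial_2\gamma=-2\gamma^2$ makes these corrections add up to a single term. This is the
    computational core of the symmetry of iterated covariant derivatives. *)
Lemma jet2S k m phi x : smooth U phi -> U x ->
  jet2 k.+1 m phi x = jet2 k m phi x - m%:R * (gamma x)%:C * jet2 k.+1 m.-1 phi x.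
Proof.
move=> sphi; have oU := half_plane_open; have sg := smooth_gamma.
elim: m x => [|m IHm] x Ux /=; first by rewrite !mul0r subr0.
have sj k' m' := smooth_jet2 k' m' sphi.
have sgj := smoothM oU sg (sj k.+1 m.-1).
have E : {in U, jet2 k.+1 m phi =1 fun x => jet2 k m phi x
    + - m%:R * ((gamma x)%:C * jet2 k.+1 m.-1 phi x)}.
  by move=> y; rewrite inE => Uy; rewrite (IHm y Uy); ring.
rewrite {1}(partial_ext oU i2 E Ux).
rewrite (partialD oU i2 (sj k m) (smoothZ oU (- m%:R) sgj) Ux).
rewrite (partialZ oU i2 _ sgj Ux) (partialM oU i2 sg (sj _ _) Ux) (partial_gamma i2 Ux).
have -> : d2 (jet2 k m phi) x = jet2 k m.+1 phi x + (k%:R - m%:R) * (gamma x)%:C * jet2 k m phi x.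
  by rewrite /=; ring.
case: m IHm sgj {E} => [|m] IHm sgj; first by rewrite /=; ring.
have -> : d2 (jet2 k.+1 m phi) x =
    jet2 k.+1 m.+1 phi x + (k.+1%:R - m%:R) * (gamma x)%:C * jet2 k.+1 m phi x.
  by rewrite /=; ring.
by rewrite !succnK (IHm x Ux) succnK -!natr1; move: (jet2 k m.+1 phi x) => y; ring.
Qed.

(** Since $\nabla_{\partial_1}\partial_1=0$, the component on [k] copies of $\partial_1$ is the
    plain derivative $\partial_1^kf$, from which [jet2] starts. *)
Definition jet k m f : 'rV[R]_2 -> R[i] := jet2 k m (iter k d1 f).

Lemma smooth_iter_partial i k f : smooth U f -> smooth U (iter k (partial i) f).
Proof. by move=> sf; elim: k => [|k IHk]; [exact: sf|exact: (smooth_partial i IHk)]. Qed.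

Lemma smooth_jet k m f : smooth U f -> smooth U (jet k m f).
Proof. by move=> sf; apply: smooth_jet2; apply: smooth_iter_partial. Qed.

(** The right-hand side is the covariant derivative along $\partial_1$ taken last, the left-hand
    side has it taken first: the tensor $\nabla^nf$ is symmetric because the connection is flat and
    torsion-free. *)
Lemma jet_succ1 k m f x : smooth U f -> U x ->
  jet k.+1 m f x = d1 (jet k m f) x - m%:R * (gamma x)%:C * jet k.+1 m.-1 f x.
Proof.
move=> sf Ux; have sk := smooth_iter_partial i1 k sf.
rewrite {1}/jet (jet2S k m (smooth_iter_partial i1 k.+1 sf) Ux).
by rewrite (partial1_jet2 k m sk Ux).
Qed.

(** The equations determine [B] along the row [m = 0] and then up each column. The coefficients of a
    flat lift are identified in this way. *)
Lemma jet_unique f (B : nat -> nat -> 'rV[R]_2 -> R[i]) :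
  (forall x, U x -> B 0%N 0%N x = f x) ->
  (forall k x, U x -> B k.+1 0%N x = d1 (B k 0%N) x) ->
  (forall k m x, U x ->
     B k m.+1 x = d2 (B k m) x - (k%:R - m%:R) * (gamma x)%:C * B k m x) ->
  forall k m x, U x -> B k m x = jet k m f x.
Proof.
move=> B0 B1 B2 k m; elim: m => [|m IHm] x Ux; last first.
  rewrite B2// /jet/= -!/(jet k m f) IHm//.
  by rewrite (partial_ext half_plane_open _ (g := jet k m f))// => y; rewrite inE; exact: IHm.
elim: k x Ux => [|k IHk] x Ux; first exact: B0.
by rewrite B1//= (partial_ext half_plane_open _ (g := iter k d1 f))// => y; rewrite inE; exact: IHk.
Qed.

(** * The operators X and 2Y + c in terms of covariant derivatives *)

Let w (x : 'rV[R]_2) : R[i] := - (2%:R * x 0 i2)%:C.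

Let smooth_w : smooth U w.
Proof. have s := smoothN half_plane_open (smooth_real half_plane_open rsmooth_x2); exact: s. Qed.

Let partial_w i x : U x -> partial i w x = - 2%:R * (i == i2)%:R.
Proof.
move=> Ux; have oU := half_plane_open.
rewrite (partialN oU _ (smooth_real oU rsmooth_x2))// partial_real.
rewrite (rpartialM (U := U))//; last 2 first.
- by apply: rsmooth_pdiff; exact: (rsmooth_cst oU).
- by apply: rsmooth_pdiff; exact: (rsmooth_coord oU).
rewrite rpartial_coord rpartial_cst eq_sym mulr0 addr0 rmorphM !rmorph_nat.
by rewrite mulNr.
Qed.

Let w_gamma x : U x -> w x * (gamma x)%:C = -1.
Proof. by move=> Ux; rewrite mulNr -rmorphM mulfV ?x2_neq0 ?inE// rmorph1. Qed.

(** Here $2Y=w\,\partial_2$ with $\partial_2w=-2$ and $w\gamma=-1$. Differentiating $w^m$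
    contributes $-2m$, so the shift $k+m$ becomes $k-m$, and $w\gamma=-1$ turns it into the
    connection term of [jet2]. *)
Lemma poch_jet2 k m phi x : smooth U phi -> U x ->
  poch (hp_Y (R := R)) k m phi x = w x ^+ m * jet2 k m phi x.
Proof.
move=> sphi; have oU := half_plane_open; elim: m x => [|m IHm] x Ux; first by rewrite mul1r.
have sj := smooth_jet2 k m sphi.
have E : {in U, poch (hp_Y (R := R)) k m phi =1 fun x => w x ^+ m * jet2 k m phi x}.
  by move=> y; rewrite inE; exact: IHm.
rewrite /= /hp_Y (partial_ext oU i2 E Ux) (IHm x Ux).
rewrite (partialM oU i2 (smoothX oU m smooth_w) sj Ux) (partialX oU i2 m smooth_w Ux).
rewrite (partial_w i2 Ux) mulr1 natrD.
have -> : 2%:R * (- (x 0 i2)%:C * (w x ^+ m * d2 (jet2 k m phi) x +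
    jet2 k m phi x * (m%:R * w x ^+ m.-1 * -2))) =
  w x * (w x ^+ m * d2 (jet2 k m phi) x + jet2 k m phi x * (m%:R * w x ^+ m.-1 * -2)).
  by rewrite /w rmorphM rmorph_nat; ring.
have -> : w x ^+ m.+1 * (d2 (jet2 k m phi) x - (k%:R - m%:R) * (gamma x)%:C * jet2 k m phi x)
  = w x ^+ m * (w x * d2 (jet2 k m phi) x - w x * (gamma x)%:C * (k%:R - m%:R) * jet2 k m phi x).
  by rewrite exprS; ring.
rewrite (w_gamma Ux); case: m {IHm sj E} => [|m]; first by rewrite !mul0r !expr0; ring.
by rewrite succnK exprS -natr1; ring.
Qed.

Let iter_partial1_w k m phi x : smooth U phi -> U x ->
  iter k d1 (fun x => w x ^+ m * phi x) x = w x ^+ m * iter k d1 phi x.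
Proof.
have oU := half_plane_open; move=> sphi; elim: k x => [//|k IHk] x Ux /=.
have E : {in U, iter k d1 (fun x => w x ^+ m * phi x) =1 fun x => w x ^+ m * iter k d1 phi x}.
  by move=> y; rewrite inE; exact: IHk.
rewrite (partial_ext oU i1 E Ux).
rewrite (partialM oU i1 (smoothX oU m smooth_w) (smooth_iter_partial i1 k sphi) Ux).
by rewrite (partialX oU i1 m smooth_w Ux) (partial_w i1 Ux) !mulr0 addr0.
Qed.

Lemma iter_X k phi x : smooth U phi -> U x ->
  iter k (hp_X (R := R)) phi x = ((x 0 i2)^-1)%:C ^+ k * iter k d1 phi x.
Proof.
have oU := half_plane_open; move=> sphi; elim: k x => [|k IHk] x Ux; first by rewrite mul1r.
(* Written as a multiple of [gamma], the coefficient of [X] is smooth and constant along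
   $\partial_1$. *)
have Exi (y : 'rV[R]_2) : ((y 0 i2)^-1)%:C = 2%:R * (gamma y)%:C :> R[i].
  have -> : (y 0 i2)^-1 = 2%:R * gamma y by rewrite /gamma invfM mulVKf// pnatr_eq0.
  by rewrite rmorphM rmorph_nat.
have sxi := smoothZ oU 2%:R smooth_gamma.
have E : {in U, iter k (hp_X (R := R)) phi =1
    fun x => (2%:R * (gamma x)%:C) ^+ k * iter k d1 phi x}.
  by move=> y; rewrite inE => Uy; rewrite (IHk y Uy) Exi.
rewrite /= /hp_X (partial_ext oU i1 E Ux).
rewrite (partialM oU i1 (smoothX oU k sxi) (smooth_iter_partial i1 k sphi) Ux).
rewrite (partialX oU i1 k sxi Ux) (partialZ oU i1 _ smooth_gamma Ux) (partial_gamma i1 Ux).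
by rewrite Exi /= exprS; ring.
Qed.

(** The powers of [w] are constant along $\partial_1$, so $X^k$ passes through them; $\partial_1^k$
    then moves inside [jet2], whose weight [k] is exactly the one in [jet k m f]. *)
Lemma X_poch k m f x : smooth U f -> U x ->
  iter k (hp_X (R := R)) (poch (hp_Y (R := R)) k m f) x =
  ((x 0 i2)^-1)%:C ^+ k * (- (2%:R * x 0 i2)%:C) ^+ m * jet k m f x.
Proof.
have oU := half_plane_open; move=> sf Ux.
have E : {in U, (fun x => w x ^+ m * jet2 k m f x) =1 poch (hp_Y (R := R)) k m f}.
  by move=> y; rewrite inE => Uy; rewrite (poch_jet2 k m sf Uy).
have sj := smooth_jet2 k m sf.
have sp := smooth_ext oU E (smoothM oU (smoothX oU m smooth_w) sj).
rewrite (iter_X k sp Ux) -mulrA; congr (_ * _); rewrite -/(w x) /jet.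
have iter_ext g h : {in U, g =1 h} -> {in U, iter k d1 g =1 iter k d1 h}.
  move=> gh; elim: (k) => [//|l IHl] y Uy /=.
  by rewrite inE in Uy; rewrite (partial_ext oU i1 IHl Uy).
rewrite -(iter_ext _ _ E) ?inE// (iter_partial1_w k m sj Ux); congr (_ * _).
have comm l : {in U, iter l d1 (jet2 k m f) =1 jet2 k m (iter l d1 f)}.
  elim: l => [//|l IHl] y Uy /=; rewrite inE in Uy.
  by rewrite (partial_ext oU i1 IHl Uy) (partial1_jet2 k m (smooth_iter_partial i1 l sf) Uy).
by rewrite comm ?inE.
Qed.

End HalfPlaneJets.

(** * Uniqueness of the Fedosov form of a flat connection *)

Section Weyl.
Variables (R : realType) (d : nat).
Local Notation multi_index := {ffun 'I_d -> nat}.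
Variables (om : 'rV[R]_d -> 'M[R]_d) (nabla : 'rV[R]_d -> 'I_d -> 'I_d -> 'rV[R]_d).
Variable U : set 'rV[R]_d.
Hypothesis openU : open U.
Implicit Types (a b : weyl R d) (al be ga : multi_index) (x : 'rV[R]_d).

Lemma sum_pred1 (i : 'I_d) : (\sum_j (j == i) = 1)%N.
Proof. by rewrite (bigD1 i)//= eqxx big1// => j /negPf ->. Qed.

Lemma mi_deg_incr al i : mi_deg (mi_incr al i) = (mi_deg al).+1.
Proof.
rewrite /mi_deg -addn1 -(sum_pred1 i) -big_split /=.
by apply: eq_bigr => j _; rewrite ffunE.
Qed.

Lemma mi_decrK al i : al i != 0%N -> mi_incr (mi_decr al i) i = al.
Proof.
move=> ali; apply/ffunP => j; rewrite !ffunE; case: eqP => [->|_].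
  by rewrite subnK// lt0n.
by rewrite subn0 addn0.
Qed.

Lemma mi_incrK al i : mi_decr (mi_incr al i) i = al.
Proof. by apply/ffunP => j; rewrite !ffunE addnK. Qed.

Lemma mi_deg_decr al i : al i != 0%N -> (mi_deg (mi_decr al i)).+1 = mi_deg al.
Proof. by move=> ali; rewrite -(mi_deg_incr _ i) mi_decrK. Qed.

(** Each [poisson_yz] differentiates once in y and once in z, so [n] of them read only coefficients
    whose two degrees are [n] higher. *)
Lemma iter_poisson_eq0 n (c : weyl2 R d) k al be x :
  (forall al' be', mi_deg al' = (mi_deg al + n)%N -> mi_deg be' = (mi_deg be + n)%N ->
     c k al' be' x = 0) ->
  iter n (poisson_yz om) c k al be x = 0.
Proof.
elim: n al be => [|n IHn] al be c0; first by apply: c0; rewrite addn0.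
rewrite /= /poisson_yz big1// => i _; rewrite big1// => j _.
by rewrite IHn ?mulr0// => al' be' Ea Eb; apply: c0; rewrite ?Ea ?Eb mi_deg_incr addSnnS.
Qed.

(** The product is graded for deg y = 1 and deg hbar = 2: every contraction trades one y and one z
    for one hbar. *)
Lemma weyl_mul_eq0 a b k ga x :
  (forall p q al be, (p.*2 + mi_deg al + (q.*2 + mi_deg be) = k.*2 + mi_deg ga)%N ->
     a p al x * b q be x = 0) ->
  weyl_mul om a b k ga x = 0.
Proof.
move=> ab0; rewrite /weyl_mul big1// => n _; rewrite big1 ?mulr0// => al _.
apply: iter_poisson_eq0 => al' be' Ea Eb; rewrite /tensor big1// => p _.
apply: ab0; rewrite {}Ea {}Eb.
have -> : mi_deg ga = (mi_deg [ffun j => al j : nat] +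
                     mi_deg [ffun j => (ga j - al j)%N])%N.
  rewrite /mi_deg -big_split; apply: eq_bigr => j _ /=; rewrite !ffunE.
  by rewrite subnKC// -ltnS.
move: (mi_deg _) (mi_deg _) => A B; have ln := ltn_ord n; have lp := ltn_ord p.
by rewrite -!addnn; lia.
Qed.

Lemma weyl_ad_eq0 a b k ga x : (forall p al, a p al x = 0) -> weyl_ad om a b k ga x = 0.
Proof.
move=> a0; rewrite /weyl_ad !weyl_mul_eq0 ?subrr ?mulr0// => p q al be _.
  by rewrite a0 mulr0.
by rewrite a0 mul0r.
Qed.

(** The covariant derivative preserves the hbar-degree and the y-degree, because each connection
    term lowers one exponent and raises one. *)
Lemma cov_eq0 i a k al x : U x ->
    (forall be y, U y -> mi_deg be = mi_deg al -> a k be y = 0) ->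
  cov nabla i a k al x = 0.
Proof.
move=> Ux a0; rewrite /cov big1 => [|p _].
  rewrite subr0 (partial_ext openU i (g := fun=> 0) _ Ux) ?partial_cst// => y.
  by rewrite inE => Uy; apply: a0.
rewrite big1// => j _; rewrite /ymul; case: ifP => [|/negbT alj]; first by rewrite mulr0.
by rewrite /dy a0 ?mulr0// mi_deg_incr mi_deg_decr.
Qed.

(** Hodge decomposition: r = delta (delta^-1 r) + delta^-1 (delta r). *)
Lemma delta_closed_eq0 (r : weyl1 R d) k x al :
    (forall be, delta_inv r k be x = 0) ->
    (forall i j be, (mi_deg be).+1 = mi_deg al ->
       dy i (r j) k be x = dy j (r i) k be x) ->
  forall i, r i k al x = 0.
Proof.
move=> r0 dr i.
have := r0 (mi_incr al i); rewrite /delta_inv => /eqP.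
rewrite mulf_eq0 invr_eq0 mi_deg_incr pnatr_eq0 /= => /eqP sum0.
(* Closedness trades each coefficient of [r j] at [al + e_i - e_j] for the one of [r i] at [al], as
   in Euler's identity. The factors add up to [mi_deg al + 1], which is nonzero. *)
have : \sum_j ((al j + (j == i))%:R * r i k al x) = 0.
  transitivity ((al i).+1%:R * \sum_j ymul j (r j) k (mi_incr al i) x); last first.
    by rewrite sum0 mulr0.
  rewrite mulr_sumr; apply: eq_bigr => j _.
  rewrite /ymul ffunE; have [alj0|alj] := eqVneq (al j + (j == i))%N 0%N.
    by rewrite alj0 mul0r mulr0.
  have [<-|neq_ij] := eqVneq i j; first by rewrite mi_incrK addn1.
  have ji : (j == i) = false by rewrite eq_sym (negPf neq_ij).
  have alj' : al j != 0%N by move: alj; rewrite ji addn0.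
  have := dr i j (mi_decr al j) (mi_deg_decr alj').
  rewrite /dy mi_decrK// !ffunE eqxx (negPf neq_ij) subn0 subn1 prednK ?lt0n// addn0 => <-.
  congr (_ * r j k _ x); apply/ffunP => l; rewrite !ffunE.
  by case: (eqVneq l j) => [->|]; rewrite ?ji ?addn0 ?subn0.
rewrite -mulr_suml -natr_sum big_split /= sum_pred1 => /eqP.
by rewrite mulf_eq0 pnatr_eq0 addn1 /= => /eqP.
Qed.

(** Induction on the total degree [k.*2 + mi_deg al]: without the curvature term the equation for
    [r] says that delta r is made of terms of lower order, which vanish by induction. Then [r] is
    delta-closed in this degree, and the normalisation by [delta_inv] kills it. *)
Lemma fedosov_form_eq0 (r : weyl1 R d) :
    (forall i j k al x, U x -> curv_form om nabla i j k al x = 0) ->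
    is_fedosov_form om nabla U r ->
  forall i k al x, U x -> r i k al x = 0.
Proof.
move=> flat [_ r3 rdelta rcurv _].
have rN N : forall i k al x, U x -> (k.*2 + mi_deg al < N)%N -> r i k al x = 0.
  elim/ltn_ind: N => N IHN i k al x Ux ltN.
  have [lt3|ge3] := ltnP (k.*2 + mi_deg al) 3; first exact: r3.
  apply: (delta_closed_eq0 (k := k) (x := x)) => [be|{}i j be degbe].
    exact: rdelta.
  have := rcurv i j k be x Ux; rewrite /weyl_curvature flat// addr0.
  rewrite cov_eq0//; last first.
    by move=> be' y Uy E; apply: (IHN (k.*2 + mi_deg al)%N) => //; lia.
  rewrite cov_eq0//; last first.
    by move=> be' y Uy E; apply: (IHN (k.*2 + mi_deg al)%N) => //; lia.
  (* Let D be the total degree under study. Dividing by hbar shifts the degree by 2 and [be] has one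
     y less than [al], so the degrees of the two factors add up to D + 1. As D >= 3, one of them is
     below D. *)
  rewrite /weyl_ad !weyl_mul_eq0; last 2 first.
  - move=> p q al' be' E; have [lt|ge] := ltnP (p.*2 + mi_deg al') (k.*2 + mi_deg al).
      by rewrite (IHN (k.*2 + mi_deg al)%N) ?mul0r.
    by rewrite mulrC (IHN (k.*2 + mi_deg al)%N) ?mul0r//; lia.
  - move=> p q al' be' E; have [lt|ge] := ltnP (p.*2 + mi_deg al') (k.*2 + mi_deg al).
      by rewrite (IHN (k.*2 + mi_deg al)%N) ?mul0r.
    by rewrite mulrC (IHN (k.*2 + mi_deg al)%N) ?mul0r//; lia.
  rewrite !subrr mulr0 !addr0 => /eqP; rewrite -subr_eq0 addrAC subrr add0r oppr_eq0 subr_eq0.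
  by move/eqP.
by move=> i k al x Ux; apply: (rN (k.*2 + mi_deg al).+1).
Qed.

End Weyl.

(** * The flat connection on the Weyl bundle *)

Section HalfPlaneWeyl.
Variable R : realType.

Local Notation U := (half_plane (R := R)).
Local Notation d1 := (partial (R := R) i1).
Local Notation d2 := (partial (R := R) i2).
Local Notation om := (hp_omega (R := R)).
Local Notation nabla := (hp_nabla (R := R)).
Implicit Types (a b F G : weyl R 2) (x : 'rV[R]_2).

Lemma big_ord2 (V : nmodType) (F : 'I_2 -> V) : \sum_i F i = F i1 + F i2.
Proof.
rewrite !big_ord_recl big_ord0 addr0.
by congr (F _ + F _); apply: val_inj.
Qed.

Lemma ord2P (P : 'I_2 -> Prop) : P i1 -> P i2 -> forall i, P i.
Proof.
by move=> P1 P2 [[|[|//]] lti]; [have -> : Ordinal lti = i1 by apply: val_inj|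
  have -> : Ordinal lti = i2 by apply: val_inj].
Qed.

Definition christoffel_coef (m i j : 'I_2) : int :=
  if m == i1 then (i != j)%:R else - ((i == i2) && (j == i2))%:R.

Lemma christoffelE m i j : christoffel nabla m i j =
  fun x => (christoffel_coef m i j)%:~R * gamma x.
Proof.
apply/funext => x; rewrite /christoffel /hp_nabla /christoffel_coef /gamma.
by move: m i j; do 3 apply: ord2P => /=; rewrite !mxE /= ?eqxx /=; ring.
Qed.

(** The derivatives of the Christoffel symbols are multiples of $\gamma^2$ and cancel against the
    quadratic terms in each of the sixteen index cases. *)
Lemma riemann_eq0 m l i j x : U x -> riemann nabla m l i j x = 0.
Proof.
move=> Ux; rewrite /riemann big_ord2 !christoffelE.
have E i' c : rpartial i' (fun x => c%:~R * gamma x) x =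
    c%:~R * (- 2%:R * (i' == i2)%:R * gamma x * gamma x) :> R.
  have oU := half_plane_open (R := R).
  have sg : rsmooth U (@gamma R) := proj1 (smooth_gamma R).
  rewrite (rpartialM i' (rsmooth_pdiff (rsmooth_cst oU c%:~R)) (rsmooth_pdiff sg) Ux).
  by rewrite rpartial_gamma// rpartial_cst mulr0 addr0.
rewrite !E /christoffel_coef.
by move: m l i j; do 4 apply: ord2P => /=; ring.
Qed.

Lemma curv_form_eq0 i j k al x : U x -> curv_form om nabla i j k al x = 0.
Proof.
move=> Ux; rewrite /curv_form big1// => p _; rewrite big1// => l _.
have u0 : 2%:R^-1 * \sum_m om x p m * riemann nabla m l i j x = 0.
  by rewrite big1 ?mulr0// => m _; rewrite riemann_eq0// mulr0.
by rewrite /ymul /weyl_cst u0; do !case: ifP.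
Qed.

(** * Taylor coefficients of sections of the Weyl bundle *)

Definition mi (p q : nat) : {ffun 'I_2 -> nat} := [ffun i => if i == i1 then p else q].

Lemma miE (al : {ffun 'I_2 -> nat}) : mi (al i1) (al i2) = al.
Proof. by apply/ffunP; apply: ord2P; rewrite ffunE. Qed.

Lemma mi_incr1 p q : mi_incr (mi p q) i1 = mi p.+1 q.
Proof. by apply/ffunP; apply: ord2P; rewrite !ffunE /= ?addn1 ?addn0. Qed.
Lemma mi_incr2 p q : mi_incr (mi p q) i2 = mi p q.+1.
Proof. by apply/ffunP; apply: ord2P; rewrite !ffunE /= ?addn1 ?addn0. Qed.
Lemma mi_decr1 p q : mi_decr (mi p q) i1 = mi p.-1 q.
Proof. by apply/ffunP; apply: ord2P; rewrite !ffunE /= ?subn1 ?subn0. Qed.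
Lemma mi_decr2 p q : mi_decr (mi p q) i2 = mi p q.-1.
Proof. by apply/ffunP; apply: ord2P; rewrite !ffunE /= ?subn1 ?subn0. Qed.

Lemma cov1E a k p q x : cov nabla i1 a k (mi p q) x =
  d1 (a k (mi p q)) x
  - (gamma x)%:C * (if q == 0%N then 0 else p.+1%:R * a k (mi p.+1 q.-1) x).
Proof.
rewrite /cov !big_ord2 !christoffelE /ymul /dy !ffunE /=.
rewrite mi_decr2 mi_incr1 subn0 /christoffel_coef /=.
by do !case: ifP => _; ring.
Qed.

(** The connection acts through $\gamma(y^1\partial_{y^1}-y^2\partial_{y^2})$, which has eigenvalue
    $(p-q)\gamma$ on $y_1^py_2^q$. *)
Lemma cov2E a k p q x : cov nabla i2 a k (mi p q) x =
  d2 (a k (mi p q)) x - (p%:R - q%:R) * (gamma x)%:C * a k (mi p q) x.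
Proof.
rewrite /cov !big_ord2 !christoffelE /ymul /dy !ffunE /=.
rewrite mi_decr1 mi_decr2 !mi_incr1 !mi_incr2 /christoffel_coef /=.
by case: p q => [|p] [|q] /=; rewrite ?subn1 ?subn0 /=; ring.
Qed.

(** The factorials turn the coefficient of y1^p y2^q into a derivative at y = 0. *)
Definition taylor a (k p q : nat) : 'rV[R]_2 -> R[i] :=
  fun x => (p`! * q`!)%:R * a k (mi p q) x.

Lemma smooth_taylor a k p q : weyl_smooth U a -> smooth U (taylor a k p q).
Proof.
move=> sa.
by have s := smoothZ (half_plane_open (R := R)) (p`! * q`!)%:R (sa k (mi p q)); exact: s.
Qed.

(** The two components of D for r = 0, acting on Taylor coefficients. Their vanishing is the
    recursion of [jet_succ1] and that of [jet2]. For [q = 0] the truncated [q.-1] is multiplied by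
    0. *)
Definition flatD1 (u : nat -> nat -> 'rV[R]_2 -> R[i]) p q x :=
  - u p.+1 q x + d1 (u p q) x - q%:R * (gamma x)%:C * u p.+1 q.-1 x.
Definition flatD2 (u : nat -> nat -> 'rV[R]_2 -> R[i]) p q x :=
  - u p q.+1 x + d2 (u p q) x - (p%:R - q%:R) * (gamma x)%:C * u p q x.

Lemma taylor_D1 r a k p q x : weyl_smooth U a -> U x ->
    (forall i k al, r i k al x = 0) ->
  taylor (Dconn om nabla r i1 a) k p q x = flatD1 (taylor a k) p q x.
Proof.
move=> sa Ux r0; have oU := half_plane_open (R := R).
rewrite /taylor /flatD1 (partialZ oU i1 _ (sa k (mi p q)) Ux) /Dconn.
rewrite (weyl_ad_eq0 _ _ _ _ (r0 i1)) cov1E /dy mi_incr1 ffunE /=.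
case: q => [|q] /=; first by rewrite factS natrM natrM !natrM; ring.
by rewrite !factS !natrM; ring.
Qed.

Lemma taylor_D2 r a k p q x : weyl_smooth U a -> U x ->
    (forall i k al, r i k al x = 0) ->
  taylor (Dconn om nabla r i2 a) k p q x = flatD2 (taylor a k) p q x.
Proof.
move=> sa Ux r0; have oU := half_plane_open (R := R).
rewrite /taylor /flatD2 (partialZ oU i2 _ (sa k (mi p q)) Ux) /Dconn.
rewrite (weyl_ad_eq0 _ _ _ _ (r0 i2)) cov2E /dy mi_incr2 ffunE /=.
by rewrite factS !natrM; ring.
Qed.

(** * Commutation of the two components of D *)

Section Flatness.
Variable u : nat -> nat -> 'rV[R]_2 -> R[i].
Hypothesis su : forall p q, smooth U (u p q).

Let oU := half_plane_open (R := R).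
Let sg := smooth_gamma R.
Let sgu p q := smoothM oU sg (su p q).

Let flatD1' p q x := (- u p.+1 q x + d1 (u p q) x) + - q%:R * ((gamma x)%:C * u p.+1 q.-1 x).
Let flatD2' p q x := (- u p q.+1 x + d2 (u p q) x) + - (p%:R - q%:R) * ((gamma x)%:C * u p q x).

Let sD1 p q := smoothD oU
  (smoothD oU (smoothN oU (su p.+1 q)) (smooth_partial i1 (su p q)))
  (smoothZ oU (- q%:R) (sgu p.+1 q.-1)).
Let sD2 p q := smoothD oU
  (smoothD oU (smoothN oU (su p q.+1)) (smooth_partial i2 (su p q)))
  (smoothZ oU (- (p%:R - q%:R)) (sgu p q)).

Let D1E p q x : flatD1' p q x = flatD1 u p q x.
Proof. by rewrite /flatD1 /flatD1'; ring. Qed.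
Let D2E p q x : flatD2' p q x = flatD2 u p q x.
Proof. by rewrite /flatD2 /flatD2'; ring. Qed.

Lemma smooth_D1 p q : smooth U (flatD1 u p q).
Proof. by apply: (smooth_ext oU _ (sD1 p q)) => x _; rewrite -D1E. Qed.

Lemma smooth_D2 p q : smooth U (flatD2 u p q).
Proof. by apply: (smooth_ext oU _ (sD2 p q)) => x _; rewrite -D2E. Qed.

Let partial_D1 i p q x : U x -> partial i (flatD1 u p q) x =
  - partial i (u p.+1 q) x + partial i (d1 (u p q)) x
  - q%:R * ((gamma x)%:C * partial i (u p.+1 q.-1) x
     - 2%:R * (i == i2)%:R * (gamma x)%:C * (gamma x)%:C * u p.+1 q.-1 x).
Proof.
move=> Ux; have E : {in U, flatD1 u p q =1 flatD1' p q} by move=> y _; rewrite D1E.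
rewrite (partial_ext oU i E Ux).
rewrite (partialD oU i (smoothD oU (smoothN oU (su p.+1 q)) (smooth_partial i1 (su p q)))
  (smoothZ oU (- q%:R) (sgu p.+1 q.-1)) Ux).
rewrite (partialD oU i (smoothN oU (su p.+1 q)) (smooth_partial i1 (su p q)) Ux).
rewrite (partialN oU i (su p.+1 q) Ux) (partialZ oU i _ (sgu p.+1 q.-1) Ux).
by rewrite (partialM oU i sg (su p.+1 q.-1) Ux) (partial_gamma i Ux); ring.
Qed.

Let partial_D2 i p q x : U x -> partial i (flatD2 u p q) x =
  - partial i (u p q.+1) x + partial i (d2 (u p q)) x
  - (p%:R - q%:R) * ((gamma x)%:C * partial i (u p q) x
     - 2%:R * (i == i2)%:R * (gamma x)%:C * (gamma x)%:C * u p q x).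
Proof.
move=> Ux; have E : {in U, flatD2 u p q =1 flatD2' p q} by move=> y _; rewrite D2E.
rewrite (partial_ext oU i E Ux).
rewrite (partialD oU i (smoothD oU (smoothN oU (su p q.+1)) (smooth_partial i2 (su p q)))
  (smoothZ oU (- (p%:R - q%:R)) (sgu p q)) Ux).
rewrite (partialD oU i (smoothN oU (su p q.+1)) (smooth_partial i2 (su p q)) Ux).
rewrite (partialN oU i (su p q.+1) Ux) (partialZ oU i _ (sgu p q) Ux).
by rewrite (partialM oU i sg (su p q) Ux) (partial_gamma i Ux); ring.
Qed.

(** Partial derivatives commute, and the terms in $\gamma^2$ cancel against
    $\partial_2\gamma=-2\gamma^2$: flatness of the connection, read on the Weyl bundle. *)
Lemma D1_D2 p q x : U x -> flatD1 (flatD2 u) p q x = flatD2 (flatD1 u) p q x.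
Proof.
move=> Ux; rewrite [LHS]/flatD1 [RHS]/flatD2 (partial_D1 i2 _ _ Ux) (partial_D2 i1 _ _ Ux).
rewrite (partialC oU i2 i1 (su p q) Ux) /flatD1 /flatD2 /=.
by case: q => [|q] /=; rewrite -?natr1; ring.
Qed.

End Flatness.

Lemma D1_ext u v p q x : (forall p q, {in U, u p q =1 v p q}) -> U x ->
  flatD1 u p q x = flatD1 v p q x.
Proof.
move=> uv Ux; rewrite /flatD1 (partial_ext (half_plane_open (R := R)) i1 (uv p q) Ux).
by rewrite !uv ?inE.
Qed.

Lemma D2_ext u v p q x : (forall p q, {in U, u p q =1 v p q}) -> U x ->
  flatD2 u p q x = flatD2 v p q x.
Proof.
move=> uv Ux; rewrite /flatD2 (partial_ext (half_plane_open (R := R)) i2 (uv p q) Ux).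
by rewrite !uv ?inE.
Qed.

Lemma fact2_neq0 p q : (p`! * q`!)%:R != 0 :> R[i].
Proof. by rewrite pnatr_eq0 -lt0n muln_gt0 !fact_gt0. Qed.

Lemma taylor_inj a b k x : (forall p q, taylor a k p q x = taylor b k p q x) ->
  forall al, a k al x = b k al x.
Proof.
move=> ab al; have := ab (al i1) (al i2); rewrite /taylor miE.
exact: mulfI (fact2_neq0 _ _) _ _.
Qed.

Lemma weyl_smooth_taylor a : (forall k p q, smooth U (taylor a k p q)) -> weyl_smooth U a.
Proof.
move=> st k al; have oU := half_plane_open (R := R).
have s := smoothZ oU ((al i1)`! * (al i2)`!)%:R^-1 (st k (al i1) (al i2)).
apply: (smooth_ext oU _ s) => x _.
by rewrite /taylor miE mulKf// fact2_neq0.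
Qed.

Definition weyl1_0 : weyl1 R 2 := fun _ _ _ _ => 0.

Lemma Dconn_sq_eq0 a i j k al x : weyl_smooth U a -> U x ->
  Dconn_sq om nabla weyl1_0 i j a k al x = 0.
Proof.
move=> sa Ux; have oU := half_plane_open (R := R).
have st k' p q := smooth_taylor k' p q sa.
have t1 k' p q : {in U, taylor (Dconn om nabla weyl1_0 i1 a) k' p q =1 flatD1 (taylor a k') p q}.
  by move=> y; rewrite inE => Uy; rewrite (taylor_D1 _ _ _ sa Uy).
have t2 k' p q : {in U, taylor (Dconn om nabla weyl1_0 i2 a) k' p q =1 flatD2 (taylor a k') p q}.
  by move=> y; rewrite inE => Uy; rewrite (taylor_D2 _ _ _ sa Uy).
(* Smoothness of D a is needed to read the second application of D on Taylor coefficients. *)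
have s1 : weyl_smooth U (Dconn om nabla weyl1_0 i1 a).
  apply: weyl_smooth_taylor => k' p q; have s := smooth_D1 (st k') p q.
  by apply: (smooth_ext oU _ s) => y /t1 ->.
have s2 : weyl_smooth U (Dconn om nabla weyl1_0 i2 a).
  apply: weyl_smooth_taylor => k' p q; have s := smooth_D2 (st k') p q.
  by apply: (smooth_ext oU _ s) => y /t2 ->.
have E12 : Dconn_sq om nabla weyl1_0 i1 i2 a k al x = 0.
  apply/eqP; rewrite /Dconn_sq subr_eq0; apply/eqP; apply: taylor_inj => p q.
  have r0 i' k' al' : weyl1_0 i' k' al' x = 0 by [].
  have E1 := taylor_D1 (r := weyl1_0) k p q s2 Ux r0.
  have E2 := taylor_D2 (r := weyl1_0) k p q s1 Ux r0.
  have E3 := D1_ext p q (t2 k) Ux.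
  have E4 := D2_ext p q (t1 k) Ux.
  exact: etrans E1 (etrans E3 (etrans (D1_D2 (st k) p q Ux) (etrans (esym E4) (esym E2)))).
move: i j; apply: ord2P; apply: ord2P; [exact: subrr|exact: E12| |exact: subrr].
by rewrite /Dconn_sq -opprB; apply/eqP; rewrite oppr_eq0; apply/eqP; exact: E12.
Qed.

(** With r = 0 and zero curvature, Fedosov's curvature form reduces to - omega. *)
Lemma fedosov_form_0 : is_fedosov_form om nabla U weyl1_0.
Proof.
have oU := half_plane_open (R := R).
split=> //.
- by move=> i k al; exact: (smooth_cst oU 0).
- by move=> k al x Ux; rewrite /delta_inv big1 ?mulr0// => j _; rewrite /ymul; case: ifP.
- move=> i j k al x Ux; rewrite /weyl_curvature curv_form_eq0//.
  rewrite (cov_eq0 _ oU)// (cov_eq0 _ oU)// weyl_ad_eq0//.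
  by rewrite /dy /weyl1_0 !mulr0 !(subr0, addr0).
- by move=> a sa i j k al x Ux; apply: Dconn_sq_eq0.
Qed.

End HalfPlaneWeyl.

(** * The star product *)

Section Star.
Variable R : realType.

Local Notation U := (half_plane (R := R)).
Local Notation om := (hp_omega (R := R)).
Local Notation nabla := (hp_nabla (R := R)).
Local Notation X := (hp_X (R := R)).
Local Notation Y := (hp_Y (R := R)).
Implicit Types (F G : weyl R 2) (f g : hseries R 2) (x : 'rV[R]_2).

Lemma mi00 : mi 0 0 = mi0 2.
Proof. by apply/ffunP; apply: ord2P; rewrite !ffunE. Qed.

(** Flatness along $\partial_1$ at [q = 0], where the connection term drops out, and along
    $\partial_2$ are the recursions of [jet_unique]. *)
Lemma flat_lift_taylor r f F k p q x :
    (forall i k al x, U x -> r i k al x = 0) -> is_flat_lift om nabla U r f F ->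
  U x -> taylor F k p q x = jet p q (f k) x.
Proof.
move=> r0 [sF flat F0]; apply: (jet_unique (B := taylor F k)) => [y|p' y|p' q' y] Uy.
- by rewrite /taylor mi00 mul1r; exact: F0.
- have := taylor_D1 k p' 0 sF Uy (fun i k al => r0 i k al y Uy).
  rewrite {1}/taylor flat// mulr0 /flatD1 mul0r mul0r subr0 addrC => /esym/eqP.
  by rewrite subr_eq0 => /eqP <-.
have := taylor_D2 k p' q' sF Uy (fun i k al => r0 i k al y Uy).
rewrite {1}/taylor flat// mulr0 /flatD2 => /esym/eqP.
by rewrite -addrA addrC subr_eq0 => /eqP <-.
Qed.

Definition lift f : weyl R 2 := fun k al x =>
  ((al i1)`! * (al i2)`!)%:R^-1 * jet (al i1) (al i2) (f k) x.

Lemma taylor_lift f k p q x : taylor (lift f) k p q x = jet p q (f k) x.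
Proof. by rewrite /taylor /lift !ffunE /= mulVKf// fact2_neq0. Qed.

(** The Taylor series along the connection is flat: in direction $\partial_1$ by the symmetry
    [jet_succ1], in direction $\partial_2$ by the very recursion of [jet2]. *)
Lemma flat_lift_exists f : (forall k, smooth U (f k)) ->
  is_flat_lift om nabla U (@weyl1_0 R) f (lift f).
Proof.
move=> sf; have oU := half_plane_open (R := R).
have sl : weyl_smooth U (lift f).
  apply: weyl_smooth_taylor => k p q; apply: (smooth_ext oU _ (smooth_jet p q (sf k))).
  by move=> x _; rewrite taylor_lift.
have r0 i' k' al' x : @weyl1_0 R i' k' al' x = 0 by [].
have tl k p q : {in U, taylor (lift f) k p q =1 jet p q (f k)}.
  by move=> x _; rewrite taylor_lift.
split=> // [i k al x Ux|k x Ux]; last first.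
  by have := taylor_lift f k 0 0 x; rewrite /taylor mul1r mi00.
move: i; apply: ord2P.
  apply: (taylor_inj (b := fun _ _ _ => 0)) => p q.
  rewrite (taylor_D1 k p q sl Ux (fun i k al => r0 i k al x)).
  rewrite (D1_ext p q (tl k) Ux) /flatD1 (jet_succ1 p q (sf k) Ux) /taylor mulr0.
  by ring.
apply: (taylor_inj (b := fun _ _ _ => 0)) => p q.
rewrite (taylor_D2 k p q sl Ux (fun i k al => r0 i k al x)).
by rewrite (D2_ext p q (tl k) Ux) /flatD2 /taylor mulr0 /jet /=; ring.
Qed.

(** * The Moyal product and its transvectants *)

Lemma invmx_hp_omega x : invmx (om x) = - om x.
Proof.
have E : om x *m (- om x) = 1%:M.
  apply/matrixP => i j; rewrite !mxE big_ord2 !mxE.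
  by move: i j; apply: ord2P; apply: ord2P; rewrite /=; ring.
by have [u _] := mulmx1_unit E; rewrite -[RHS]mul1mx -(mulVmx u) -mulmxA E mulmx1.
Qed.

(** With this normalisation, derivatives in y and z become index shifts without coefficients. *)
Definition taylor2 (c : weyl2 R 2) k p q r s x : R[i] :=
  (p`! * q`! * (r`! * s`!))%:R * c k (mi p q) (mi r s) x.

(** The inverse matrix has $\omega^{12}=-1$ and $\omega^{21}=1$, so the bidifferential operator is
    $\partial_{y^2}\partial_{z^1}-\partial_{y^1}\partial_{z^2}$. *)
Lemma taylor2_poisson c k p q r s x :
  taylor2 (poisson_yz om c) k p q r s x =
  taylor2 c k p q.+1 r.+1 s x - taylor2 c k p.+1 q r s.+1 x.
Proof.
rewrite /taylor2 /poisson_yz invmx_hp_omega !big_ord2 !mxE !ffunE /=.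
rewrite !mi_incr1 !mi_incr2 !factS !natrM.
by ring.
Qed.

(** With S the shift of sequences, this is $(1-S)^{n+1}A=(1-S)^nA-(1-S)^nSA$ at 0, by Pascal's
    rule. *)
Lemma alternating_pascal (K : pzRingType) n (A : nat -> K) :
  \sum_(m < n.+2) (-1) ^+ m * 'C(n.+1, m)%:R * A m =
  \sum_(m < n.+1) (-1) ^+ m * 'C(n, m)%:R * A m
  - \sum_(m < n.+1) (-1) ^+ m * 'C(n, m)%:R * A m.+1.
Proof.
have -> : \sum_(m < n.+1) (-1) ^+ m * 'C(n, m)%:R * A m =
          \sum_(m < n.+2) (-1) ^+ m * 'C(n, m)%:R * A m.
  by rewrite [RHS]big_ord_recr /= bin_small// mulr0 mul0r addr0.
rewrite big_ord_recl [in RHS]big_ord_recl !bin0 -addrA; congr (_ + _).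
rewrite -sumrB; apply: eq_bigr => m _; rewrite binS natrD mulrDr mulrDl; congr (_ + _).
by rewrite exprS mulN1r !mulNr.
Qed.

(** The binomial theorem for the two commuting terms of the Poisson operator; [m] counts the uses of
    $\partial_{y^1}\partial_{z^2}$. *)
Lemma taylor2_iter_poisson c n k p q r s x :
  taylor2 (iter n (poisson_yz om) c) k p q r s x =
  \sum_(m < n.+1) (-1) ^+ m * 'C(n, m)%:R *
    taylor2 c k (p + m) (q + (n - m)) (r + (n - m)) (s + m) x.
Proof.
elim: n p q r s => [|n IHn] p q r s.
  by rewrite big_ord_recl big_ord0 /= !addn0 bin0 !mul1r addr0.
rewrite iterS taylor2_poisson !IHn.
rewrite (alternating_pascal n (fun m =>
  taylor2 c k (p + m) (q + (n.+1 - m)) (r + (n.+1 - m)) (s + m) x)).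
congr (_ - _); apply: eq_bigr => m _ /=.
  have -> : (n.+1 - m = (n - m).+1)%N by rewrite subSn// -ltnS.
  by rewrite !addnS !addSn.
by rewrite subSS !addnS !addSn.
Qed.

Lemma taylor2_tensor F G k p q r s x : taylor2 (tensor F G) k p q r s x =
  \sum_(i < k.+1) taylor F i p q x * taylor G (k - i) r s x.
Proof.
rewrite /taylor2 /tensor mulr_sumr; apply: eq_bigr => i _.
by rewrite /taylor !natrM; ring.
Qed.

Lemma weyl_mul_mi0 F G k x : weyl_mul om F G k (mi0 2) x =
  \sum_(n < k.+1) (- 'i%C / 2%:R) ^+ n / (n`!)%:R *
    iter n (poisson_yz om) (tensor F G) (k - n)%N (mi0 2) (mi0 2) x.
Proof.
apply: eq_bigr => n _; congr (_ * _).
have mi0E j : mi0 2 j = 0%N by rewrite ffunE.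
have al0 (al : {dffun forall j, 'I_((mi0 2 j).+1)}) j : al j = 0%N :> nat.
  by move: (ltn_ord (al j)); move: (nat_of_ord (al j)) => i; rewrite mi0E; case: i.
pose a0 : {dffun forall j, 'I_((mi0 2 j).+1)} := finfun (fun=> ord0).
have alE (al : {dffun forall j, 'I_((mi0 2 j).+1)}) : al = a0.
  apply/ffunP => j; apply: val_inj; rewrite [LHS]al0 [RHS]al0; by [].
rewrite (big_pred1 a0) => [|al]; last by rewrite (alE al) /= eqxx.
have E1 : [ffun j => a0 j : nat] = mi0 2 by apply/ffunP => j; rewrite ffunE al0 mi0E.
have E2 : [ffun j => (mi0 2 j - a0 j)%N] = mi0 2 by apply/ffunP => j; rewrite ffunE al0 subn0.
by rewrite E1 E2.
Qed.

Lemma symbol_weyl_mul F G k x :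
  symbol (weyl_mul om F G) k x =
  \sum_(n < k.+1) (- 'i%C / 2%:R) ^+ n / (n`!)%:R *
   \sum_(m < n.+1) (-1) ^+ m * 'C(n, m)%:R *
    \sum_(p < (k - n).+1) taylor F p m (n - m) x * taylor G (k - n - p) (n - m) m x.
Proof.
rewrite /symbol weyl_mul_mi0; apply: eq_bigr => n _; congr (_ * _).
have := taylor2_iter_poisson (tensor F G) n (k - n) 0 0 0 0 x.
rewrite {1}/taylor2 mul1r mi00 => ->; apply: eq_bigr => m _.
by rewrite taylor2_tensor !add0n.
Qed.

(** The sums agree term by term: by [X_poch], the prefactors of the two arguments multiply to
    $(x_2^{-1}\cdot(-2x_2))^n=(-2)^n$ for every [m], and $\frac1{m!(n-m)!}=\frac1{n!}\binom nm$. *)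
Lemma rankin_cohen_jet (n : nat) (a b : 'rV[R]_2 -> R[i]) x :
    smooth U a -> smooth U b -> U x ->
  ('i%C / 4%:R) ^+ n * rankin_cohen X Y n a b x =
  (- 'i%C / 2%:R) ^+ n / (n`!)%:R * \sum_(m < n.+1) (-1) ^+ m * 'C(n, m)%:R *
     (jet m (n - m) a x * jet (n - m) m b x).
Proof.
move=> sa sb Ux; rewrite /rankin_cohen !mulr_sumr; apply: eq_bigr => m _.
have lemn : (m <= n)%N by rewrite -ltnS.
rewrite (X_poch _ _ sa Ux) (X_poch _ _ sb Ux) -(bin_fact lemn).
move: (nat_of_ord m) lemn => {}m lemn.
move: (subnKC lemn) (bin_gt0 n m); rewrite lemn; move: (n - m)%N => l <-.
rewrite lt0n -(pnatr_eq0 R[i]) !natrM; move: 'C(m + l, m)%:R => B B0.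
have fact0 p : p`!%:R != 0 :> R[i] by rewrite pnatr_eq0 -lt0n fact_gt0.
move: m`!%:R l`!%:R (fact0 m) (fact0 l) => P Q P0 Q0.
pose w : R[i] := - (2%:R * x 0 i2)%:C; pose v : R[i] := ((x 0 i2)^-1)%:C.
have vw : v * w = - 2%:R.
  rewrite /v /w mulrN -rmorphM mulrCA mulVf; last by apply: lt0r_neq0.
  by rewrite mulr1 rmorph_nat.
(* This fixes the scale: the factor -2 carries $i/4$ to the $-i/2$ of the Weyl product. *)
have -> : - 'i%C / 2%:R = 'i%C / 4%:R * (v * w) :> R[i] by rewrite vw; field.
rewrite -/w -/v !exprMn !exprD; move: (v ^+ m) (v ^+ l) (w ^+ m) (w ^+ l) => vm vl wm wl.
move: ((-1) ^+ m) ('i%C ^+ m) ('i%C ^+ l) (4%:R^-1 ^+ m) (4%:R^-1 ^+ l) => *.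
by field; rewrite B0 P0 Q0.
Qed.

Lemma fedosov_star_rc r f g F G k x :
    (forall i k al x, U x -> r i k al x = 0) ->
    is_flat_lift om nabla U r f F -> is_flat_lift om nabla U r g G ->
    (forall k, smooth U (f k)) -> (forall k, smooth U (g k)) -> U x ->
  symbol (weyl_mul om F G) k x = rc_star X Y ('i%C / 4%:R) f g k x.
Proof.
move=> r0 fF gG sf sg Ux; rewrite symbol_weyl_mul /rc_star.
apply: eq_bigr => n _; rewrite [RHS]mulr_sumr.
under [RHS]eq_bigr => p _ do rewrite (rankin_cohen_jet n (sf p) (sg _) Ux).
rewrite -mulr_sumr exchange_big /=; congr (_ * _); apply: eq_bigr => m _.
rewrite -mulr_sumr; congr (_ * _); apply: eq_bigr => p _.
by rewrite (flat_lift_taylor _ _ _ r0 fF Ux) (flat_lift_taylor _ _ _ r0 gG Ux).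
Qed.

End Star.

Theorem corollary3p5 (R : realType) (f g h : hseries R 2)
    (hf : forall k, smooth (half_plane (R := R)) (f k))
    (hg : forall k, smooth (half_plane (R := R)) (g k)) :
  is_fedosov_star (hp_omega (R := R)) (hp_nabla (R := R))
    (half_plane (R := R)) f g h <->
  (forall k x, half_plane x ->
     h k x = rc_star (hp_X (R := R)) (hp_Y (R := R)) ('i%C / 4%:R) f g k x).
Proof.
split=> [[r [F [G [fr fF fG hE]]]] k x Ux|hE].
  (* The given form is arbitrary, but uniqueness forces it to vanish on the half-plane. *)
  have r0 := fedosov_form_eq0 (half_plane_open (R := R)) (@curv_form_eq0 R) fr.
  by rewrite (hE k x Ux) (fedosov_star_rc k r0 fF fG hf hg Ux).
have lf := flat_lift_exists hf; have lg := flat_lift_exists hg.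
(* Conversely the zero form and the parallel Taylor expansions realise Fedosov's product. *)
exists (@weyl1_0 R), (lift f), (lift g); split=> // [|k x Ux].
  exact: fedosov_form_0.
by rewrite (hE k x Ux) (fedosov_star_rc k _ lf lg hf hg Ux).
Qed.
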